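(* Let $d\ge 1$ and $m\in\mathbb{N}$. Let $\mathcal{A}$ be the adjacency matrix of $\mathbb{Z}^d$ acting on $\ell^2(\mathbb{Z}^d)$, i.e. $(\mathcal{A}\psi)(n)=\sum_{j=1}^d\bigl(\psi(n-\mathfrak{e}_j)+\psi(n+\mathfrak{e}_j)\bigr)$, where $\{\mathfrak{e}_j\}$ is the standard basis of $\mathbb{Z}^d$. For $k\ge 1$ define the $k$-step adjacency operator $(S_k\psi)(n)=\sum_{j=1}^d\bigl(\psi(n-k\mathfrak{e}_j)+\psi(n+k\mathfrak{e}_j)\bigr)$. For $\psi\in\ell^2(\mathbb{Z}^d)$ let $n^m\psi\colon\mathbb{Z}^d\to\mathbb{C}^d$, $n^m\psi(n)=(n_1^m\psi(n),\dots,n_d^m\psi(n))$, with $\|n^m\psi\|^2=\sum_{n}\sum_{j=1}^d |n_j|^{2m}|\psi(n)|^2$. Then for every $\psi\in\ell^2(\mathbb{Z}^d)$ with $\|n^m\psi\|<\infty$, $$\lim_{t\to+\infty}\frac{\|n^m e^{\mathrm{i}t\mathcal{A}}\psi\|^2}{t^{2m}}=d\binom{2m}{m}\|\psi\|^2+\sum_{q=0}^{m-1}\binom{2m}{q}(-1)^{q+m}\langle\psi,S_{2m-2q}\psi\rangle .$$ Moreover, this limit is strictly positive if $\psi\neq 0$, and it is at most $4^m d\|\psi\|^2$.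
   Context: $\langle\phi,\psi\rangle=\sum_{n\in\mathbb{Z}^d}\overline{\phi(n)}\psi(n)$. *)

(* Defs.v *)
From mathcomp Require Import all_boot all_order all_algebra.
From mathcomp Require Import all_classical all_reals all_analysis.
From mathcomp Require Import complex.
Set Implicit Arguments. Unset Strict Implicit. Unset Printing Implicit Defensive.
Import Order.TTheory GRing.Theory Num.Theory.
Import numFieldNormedType.Exports.
Local Open Scope ring_scope.
Local Open Scope complex_scope.

Definition ebasis (d : nat) (j : 'I_d) : 'rV[int]_d := delta_mx 0 j.

(* the box [-N, N]^d, enumerated through 'rV['I_(2N+1)]_d *)
Definition box_pt (d N : nat) (x : 'rV['I_(N.*2.+1)]_d) : 'rV[int]_d :=
  \row_j ((x 0 j : nat)%:Z - N%:Z).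

Definition boxsum (V : nmodType) (d N : nat) (f : 'rV[int]_d -> V) : V :=
  \sum_(x : 'rV['I_(N.*2.+1)]_d) f (box_pt x).

Definition absq (R : realType) (z : R[i]) : R :=
  (complex.Re z) ^+ 2 + (complex.Im z) ^+ 2.

(* psi is in l^2(Z^d): the (monotone) box partial sums of |psi|^2 converge *)
Definition in_l2 (R : realType) (d : nat) (psi : 'rV[int]_d -> R[i]) : Prop :=
  cvgn (fun N => boxsum N (fun n => absq (psi n))).

Definition l2normsq (R : realType) (d : nat) (psi : 'rV[int]_d -> R[i]) : R :=
  limn (fun N => boxsum N (fun n => absq (psi n))).

Definition l2inner (R : realType) (d : nat) (phi psi : 'rV[int]_d -> R[i]) : R[i] :=
  limn ((fun N => boxsum N (fun n => (phi n)^* * psi n)) : nat -> (R[i])^o).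

Definition moment_summand (R : realType) (d m : nat) (psi : 'rV[int]_d -> R[i])
    (n : 'rV[int]_d) : R :=
  \sum_(j < d) ((n 0 j)%:~R ^+ (m.*2)) * absq (psi n).

Definition moment_finite (R : realType) (d m : nat) (psi : 'rV[int]_d -> R[i]) : Prop :=
  cvgn (fun N => boxsum N (moment_summand m psi)).

Definition moment_normsq (R : realType) (d m : nat) (psi : 'rV[int]_d -> R[i]) : R :=
  limn (fun N => boxsum N (moment_summand m psi)).

Definition Sk (R : realType) (d k : nat) (psi : 'rV[int]_d -> R[i]) : 'rV[int]_d -> R[i] :=
  fun n => \sum_(j < d) (psi (n - ebasis j *+ k) + psi (n + ebasis j *+ k)).

Definition adjA (R : realType) (d : nat) (psi : 'rV[int]_d -> R[i]) : 'rV[int]_d -> R[i] :=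
  Sk 1 psi.

(* e^{itA} psi, via the exponential series of the bounded operator A,
   evaluated pointwise: (e^{itA} psi)(n) = sum_k (it)^k/k! (A^k psi)(n) *)
Definition expitA (R : realType) (d : nat) (t : R) (psi : 'rV[int]_d -> R[i])
    : 'rV[int]_d -> R[i] :=
  fun n => limn ((fun K => \sum_(k < K)
      (('i * t%:C) ^+ k / (k`!)%:R * iter k (@adjA R d) psi n)) : nat -> (R[i])^o).

(* Main.v *)
(** With H = iA, a skew operator, and s = 1/t, commuting the coordinate n_j
    through the exponential gives n_j e^{tH} = t e^{tH} (s n_j + i D_j), where
    (D_j phi)(n) = phi(n - e_j) - phi(n + e_j) is the commutator of n_j and A.
    Hence |n_j^m e^{tH} psi| / t^m = |(s n_j + i D_j)^m psi| by unitarity, and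
    this differs from |(i D_j)^m psi| by O(s), the remainder being bounded
    because i D_j preserves the spaces weighted by (1 + n_j^2)^a and n_j lowers
    a by one.  The limit is therefore the sum over j of |D_j^m psi|^2; expanding
    D_j^(2m) binomially yields the formula, |D_j| <= 2 the upper bound, and the
    injectivity of D_j on l^2 the positivity. *)
Require Import Defs.
From mathcomp Require Import all_boot all_order all_algebra.
From mathcomp Require Import all_classical all_reals all_analysis.
From mathcomp Require Import complex.
From mathcomp Require Import ring lra zify.
Set Implicit Arguments. Unset Strict Implicit. Unset Printing Implicit Defensive.
Import Order.TTheory GRing.Theory Num.Theory.
Import numFieldNormedType.Exports.
Local Open Scope classical_set_scope.
Local Open Scope ring_scope.
Local Open Scope complex_scope.

(** * Sums over boxes *)

Section BoxSums.
Variables (R : realType) (d : nat).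
Implicit Types (f g : 'rV[int]_d -> R) (v n : 'rV[int]_d) (N : nat).

(** The exponential is defined coordinate by coordinate, so neither square summability nor the norm
    of the evolved state comes for free. Both rest on skewness: the Gram matrix of the vectors H^k
    phi has entries (-1)^k B(k + l), so the squared norm of a partial sum is a double sum that
    collapses along antidiagonals by the binomial theorem, since (-t + t)^N = 0 for N > 0. Tail
    bounds and passage to the limit on finite boxes then give convergence in norm.

    The operators n_j and D_j do not commute, and (s n_j + i D_j)^m is never expanded: a recursion
    on the power carries the remainder. Norms are only handled squared; Young's inequality with a
    weight chosen at each use replaces Cauchy-Schwarz and avoids square roots. *)

Definition box N : seq 'rV[int]_d :=
  [seq box_pt x | x <- enum {: 'rV['I_(N.*2.+1)]_d}].

Lemma boxsumE (V : nmodType) N (f : 'rV[int]_d -> V) :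
  boxsum N f = \sum_(n <- box N) f n.
Proof. by rewrite /boxsum /box big_map big_enum. Qed.

Lemma mem_box N n : (n \in box N) = [forall j, (absz (n 0%R j) <= N)%N].
Proof.
have bnd (k : nat) : (k < N.*2.+1)%N -> (absz (k%:Z - N%:Z)%R <= N)%N.
  by rewrite -addnn; lia.
have bnd' (z : int) : (absz z <= N)%N -> (absz (z + N%:Z)%R < N.*2.+1)%N.
  by rewrite -addnn; lia.
apply/mapP/forallP => [[x _ ->] j|H]; first by rewrite mxE bnd.
exists (\row_j Ordinal (bnd' _ (H j))); first by rewrite mem_enum.
apply/rowP => j; rewrite !mxE /=; have := H j.
by move: (n 0 j) => z; lia.
Qed.

Lemma box_uniq N : uniq (box N).
Proof.
rewrite map_inj_uniq ?enum_uniq// => x y /rowP xy; apply/rowP => j.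
have := xy j; rewrite !mxE => /addIr[xyj]; exact: val_inj.
Qed.

Lemma sub_box (s : seq 'rV[int]_d) : exists N, {subset s <= box N}.
Proof.
exists (\max_(n <- s) \max_(j < d) absz (n 0%R j)) => n ns; rewrite mem_box.
apply/forallP => j; apply: leq_trans (leq_bigmax_seq _ ns _) => //.
exact: (leq_bigmax_cond (F := fun j => absz (n 0%R j))).
Qed.

Lemma ler_boxsum f g N : (forall n, f n <= g n) -> boxsum N f <= boxsum N g.
Proof. by move=> fg; apply: ler_sum. Qed.

Lemma boxsum_ge0 f N : (forall n, 0 <= f n) -> 0 <= boxsum N f.
Proof. by move=> f0; apply: sumr_ge0. Qed.

Lemma boxsumD f g N : boxsum N (fun n => f n + g n) = boxsum N f + boxsum N g.
Proof. by rewrite /boxsum big_split. Qed.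

Lemma boxsumZ (a : R) f N : boxsum N (fun n => a * f n) = a * boxsum N f.
Proof. by rewrite /boxsum mulr_sumr. Qed.

Lemma ler_sum_box (s : seq 'rV[int]_d) f N : (forall n, 0 <= f n) -> uniq s ->
  {subset s <= box N} -> \sum_(n <- s) f n <= boxsum N f.
Proof.
move=> f0 us sN.
rewrite (perm_big [seq n <- box N | n \in s]); last first.
  apply: uniq_perm; rewrite ?filter_uniq ?box_uniq// => n.
  by rewrite mem_filter; case: (boolP (n \in s)) => // /sN ->.
rewrite big_filter boxsumE [leRHS](bigID (mem s)) lerDl.
by apply: sumr_ge0.
Qed.

Lemma boxsum_nondecreasing f N M : (forall n, 0 <= f n) -> (N <= M)%N ->
  boxsum N f <= boxsum M f.
Proof.
move=> f0 NM; rewrite [leLHS]boxsumE; apply: ler_sum_box => //.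
  exact: box_uniq.
move=> n; rewrite !mem_box => /forallP nN; apply/forallP => j.
exact: leq_trans (nN j) NM.
Qed.

(** A translated box is not a centred box, but it lies in a larger one. The enlargement depends on
    [v] alone, which makes bounds on box sums stable under translation. *)
Lemma boxsum_shift_le v : exists M, forall f N, (forall n, 0 <= f n) ->
  boxsum N (fun n => f (n + v)) <= boxsum (N + M) f.
Proof.
have [M vM] := sub_box [:: v]; exists M => f N f0.
rewrite boxsumE -(big_map (fun n => n + v) xpredT f); apply: ler_sum_box => //.
  by rewrite map_inj_uniq ?box_uniq//; exact: addIr.
have := vM v; rewrite inE eqxx mem_box => /(_ isT)/forallP vj.
move=> _ /mapP[n nN ->]; rewrite mem_box; apply/forallP => j.
move: nN; rewrite mem_box mxE => /forallP/(_ j).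
by have := vj j; move: (n 0 j) (v 0 j) => a b; lia.
Qed.

(** Absolute summability as a bound on finite sums: comparison, addition and translation are then
    proved without limits. The value [tsum] is meaningful only under this condition. *)
Definition summ f := exists C, forall N, boxsum N (fun n => `|f n|) <= C.

Definition tsum f : R := limn (fun N => boxsum N f).

Lemma summ_le f g : (forall n, `|f n| <= g n) -> summ g -> summ f.
Proof.
move=> fg [C gC]; exists C => N; apply: le_trans (gC N); apply: ler_boxsum => n.
exact: le_trans (fg n) (ler_norm _).
Qed.

Lemma summ_abs f : summ f -> summ (fun n => `|f n|).
Proof. by move=> [C fC]; exists C => N; under eq_fun do rewrite normr_id. Qed.

Lemma summD f g : summ f -> summ g -> summ (fun n => f n + g n).
Proof.
move=> [C fC] [D gD]; exists (C + D) => N.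
apply: le_trans (lerD (fC N) (gD N)); rewrite -boxsumD; apply: ler_boxsum => n.
exact: ler_normD.
Qed.

Lemma summZ a f : summ f -> summ (fun n => a * f n).
Proof.
move=> [C fC]; exists (`|a| * C) => N.
apply: le_trans (ler_wpM2l (normr_ge0 a) (fC N)); rewrite -boxsumZ.
by apply: ler_boxsum => n; rewrite normrM.
Qed.

Lemma summ0 : summ (fun=> 0).
Proof.
by exists 0 => N; rewrite /boxsum big1// => i _; rewrite normr0.
Qed.

Lemma summ_sum (I : Type) (r : seq I) (F : I -> 'rV[int]_d -> R) :
  (forall i, summ (F i)) -> summ (fun n => \sum_(i <- r) F i n).
Proof.
move=> sF; elim: r => [|i r IH].
  by rewrite (_ : (fun _ => _) = fun=> 0); [exact: summ0|apply/funext => n; rewrite big_nil].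
rewrite (_ : (fun _ => _) = fun n => F i n + \sum_(i <- r) F i n).
  exact: summD.
by apply/funext => n; rewrite big_cons.
Qed.

Lemma summ_shift v f : summ f -> summ (fun n => f (n + v)).
Proof.
move=> [C fC]; have [M HM] := boxsum_shift_le v; exists C => N.
exact: le_trans (HM (fun n => `|f n|) N (fun=> normr_ge0 _)) (fC _).
Qed.

Lemma summ_ge0_cvg f : (forall n, 0 <= f n) -> summ f ->
  cvgn (fun N => boxsum N f).
Proof.
move=> f0 [C fC]; apply: nondecreasing_is_cvgn.
  by move=> N M; exact: boxsum_nondecreasing.
exists C => _ [N _ <-]; apply: le_trans (fC N); apply: ler_boxsum => n.
exact: ler_norm.
Qed.

(** Since f = (f + |f|) - |f| is a difference of nonnegative summable functions, monotone
    convergence of box sums suffices. *)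
Lemma summ_cvg f : summ f -> boxsum N f @[N --> \oo] --> tsum f.
Proof.
move=> sf; have sa := summ_abs sf.
suff : cvgn (fun N => boxsum N f) by [].
have -> : (fun N => boxsum N f) =
  (fun N => boxsum N (fun n => f n + `|f n|)) \- (fun N => boxsum N (fun n => `|f n|)).
  by apply/funext => N /=; rewrite boxsumD addrK.
apply: is_cvgB; apply: summ_ge0_cvg => //; last exact: summD.
by move=> n; have := ler_norm (- f n); rewrite normrN; lra.
Qed.

Lemma cvgn_summ f : (forall n, 0 <= f n) -> cvgn (fun N => boxsum N f) -> summ f.
Proof.
move=> f0 cf; exists (tsum f) => N.
rewrite (_ : (fun n => `|f n|) = f); last by apply/funext => n; rewrite ger0_norm.
apply: (nondecreasing_cvgn_le (u_ := fun N => boxsum N f)) => //.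
by move=> ? ?; exact: boxsum_nondecreasing.
Qed.

Lemma tsum_eq f l : boxsum N f @[N --> \oo] --> l -> tsum f = l.
Proof. exact: cvg_lim. Qed.

Lemma tsumD f g : summ f -> summ g -> tsum (fun n => f n + g n) = tsum f + tsum g.
Proof.
move=> sf sg; apply: tsum_eq; under eq_fun do rewrite boxsumD.
by apply: cvgD; exact: summ_cvg.
Qed.

Lemma tsumZ a f : summ f -> tsum (fun n => a * f n) = a * tsum f.
Proof.
move=> sf; apply: tsum_eq; under eq_fun do rewrite boxsumZ.
by apply: cvgMr; exact: summ_cvg.
Qed.

Lemma tsum0 : tsum (fun=> 0) = 0.
Proof.
apply: tsum_eq; rewrite (_ : (fun N => _) = fun=> 0); first exact: cvg_cst.
by apply/funext => N; rewrite /boxsum big1.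
Qed.

Lemma tsum_sum (I : Type) (r : seq I) (F : I -> 'rV[int]_d -> R) :
  (forall i, summ (F i)) ->
  tsum (fun n => \sum_(i <- r) F i n) = \sum_(i <- r) tsum (F i).
Proof.
move=> sF; elim: r => [|i r IH].
  rewrite big_nil -[RHS]tsum0; congr tsum.
  by apply/funext => n; rewrite big_nil.
rewrite big_cons -IH -tsumD//; last exact: summ_sum.
by congr tsum; apply/funext => n; rewrite big_cons.
Qed.

Lemma boxsum_le_tsum f N : (forall n, 0 <= f n) -> summ f -> boxsum N f <= tsum f.
Proof.
move=> f0 sf; apply: (nondecreasing_cvgn_le (u_ := fun N => boxsum N f)).
  by move=> ? ?; exact: boxsum_nondecreasing.
exact: summ_cvg.
Qed.

Lemma tsum_le_ub f C : summ f -> (forall N, boxsum N f <= C) -> tsum f <= C.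
Proof.
by move=> sf fC; apply: limr_le; [exact: summ_cvg|exact: nearW].
Qed.

Lemma tsum_ge0 f : (forall n, 0 <= f n) -> summ f -> 0 <= tsum f.
Proof.
by move=> f0 sf; apply: le_trans (boxsum_ge0 0 f0) (boxsum_le_tsum _ _ _).
Qed.

Lemma ler_tsum f g : summ f -> summ g -> (forall n, f n <= g n) -> tsum f <= tsum g.
Proof.
move=> sf sg fg; apply: ler_lim; [exact: summ_cvg|exact: summ_cvg|].
by apply: nearW => N; exact: ler_boxsum.
Qed.

Lemma le_tsum f n : (forall n, 0 <= f n) -> summ f -> f n <= tsum f.
Proof.
move=> f0 sf; have [N nN] := sub_box [:: n].
rewrite -[f n](@big_seq1 _ 0 +%R).
by apply: le_trans (ler_sum_box _ _ nN) (boxsum_le_tsum _ _ _).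
Qed.

Lemma tsum_shift_le v f : (forall n, 0 <= f n) -> summ f ->
  tsum (fun n => f (n + v)) <= tsum f.
Proof.
move=> f0 sf; have [M HM] := boxsum_shift_le v.
apply: tsum_le_ub; first exact: summ_shift.
by move=> N; apply: le_trans (HM _ _ f0) (boxsum_le_tsum _ _ _).
Qed.

(** For nonnegative functions the inequality for [v] and the one for [- v] give equality; the
    general case follows by subtracting |f| from f + |f|. *)
Lemma tsum_shift v f : summ f -> tsum (fun n => f (n + v)) = tsum f.
Proof.
have pos g : (forall n, 0 <= g n) -> summ g -> tsum (fun n => g (n + v)) = tsum g.
  move=> g0 sg; apply/eqP; rewrite eq_le tsum_shift_le//=.
  have := @tsum_shift_le (- v) (fun n => g (n + v)) (fun=> g0 _) (summ_shift v sg).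
  by under eq_fun do rewrite subrK.
move=> sf; have sa := summ_abs sf.
have sfa : summ (fun n => f n + `|f n|) by exact: summD.
have fa0 n : 0 <= f n + `|f n| by have := ler_norm (- f n); rewrite normrN; lra.
have := pos _ fa0 sfa; rewrite tsumD ?tsumD//; last first.
- exact: (summ_shift v sa).
- exact: summ_shift.
by rewrite (pos (fun n => `|f n|))// => /addIr.
Qed.

End BoxSums.

(** * The underlying real Hilbert space *)

Section RealDot.
Variable R : realType.
Implicit Types (z w : R[i]) (a : R).

(* [Re (z^* w)]: l^2 is used as a real Hilbert space, where [iA] is skew. *)
Definition dotc z w : R :=
  complex.Re z * complex.Re w + complex.Im z * complex.Im w.

Lemma ReB z w : complex.Re (z - w) = complex.Re z - complex.Re w.
Proof. by case: z w => [? ?] []. Qed.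

Lemma ImB z w : complex.Im (z - w) = complex.Im z - complex.Im w.
Proof. by case: z w => [? ?] []. Qed.

Lemma absqE z : absq z = dotc z z.
Proof. by rewrite /absq /dotc !expr2. Qed.

Lemma absq_ge0 z : 0 <= absq z.
Proof. by rewrite addr_ge0 ?sqr_ge0. Qed.

Lemma absq0 : absq (0 : R[i]) = 0.
Proof. by rewrite /absq /= expr0n addr0. Qed.

Lemma absq_eq0 z : absq z = 0 -> z = 0.
Proof.
case: z => x y; rewrite /absq /= => /eqP.
by rewrite paddr_eq0 ?sqr_ge0// !sqrf_eq0 => /andP[/eqP-> /eqP->].
Qed.

Lemma absqM z w : absq (z * w) = absq z * absq w.
Proof. by case: z w => [x y] [u v]; rewrite /absq /=; ring. Qed.

Lemma absqC a : absq a%:C = a ^+ 2.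
Proof. by rewrite /absq /=; ring. Qed.

Lemma absqZ a z : absq (a%:C * z) = a ^+ 2 * absq z.
Proof. by rewrite absqM absqC. Qed.

Lemma absq_iM z : absq ('i * z) = absq z.
Proof. by rewrite absqM /absq /=; ring. Qed.

Lemma absqN z : absq (- z) = absq z.
Proof. by case: z => x y; rewrite /absq /=; ring. Qed.

Lemma absqD z w : absq (z + w) = absq z + absq w + 2 * dotc z w.
Proof. by case: z w => [x y] [u v]; rewrite /absq /dotc /=; ring. Qed.

Lemma dotcC z w : dotc z w = dotc w z.
Proof. by rewrite /dotc; ring. Qed.

Lemma dotcDl z w u : dotc (z + w) u = dotc z u + dotc w u.
Proof. by case: z w => [x y] [s t]; rewrite /dotc /=; ring. Qed.

Lemma dotcZl a z w : dotc (a%:C * z) w = a * dotc z w.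
Proof. by case: z => [x y]; rewrite /dotc /=; ring. Qed.

Lemma dotc_iM z w : dotc ('i * z) w = - dotc z ('i * w).
Proof. by case: z w => [x y] [s t]; rewrite /dotc /=; ring. Qed.

Lemma dotc0l w : dotc 0 w = 0.
Proof. by rewrite /dotc /=; ring. Qed.

(** Completing the square: for a sign s, the sum of the right side and s times the product is |e s z
    + w|^2 / (2 e), hence nonnegative. *)
Lemma dotc_young e z w : 0 < e -> `|dotc z w| <= e / 2 * absq z + e^-1 / 2 * absq w.
Proof.
move=> e0; have ei : e^-1 * e = 1 by rewrite mulVf ?gt_eqF.
have ei0 : 0 < e^-1 by rewrite invr_gt0.
have key (s : R) : s ^+ 2 = 1 ->
    0 <= e / 2 * absq z + e^-1 / 2 * absq w + s * dotc z w.
  move=> s1; suff -> : e / 2 * absq z + e^-1 / 2 * absq w + s * dotc z w =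
    e^-1 / 2 * absq ((e * s)%:C * z + w).
    by rewrite mulr_ge0 ?absq_ge0// divr_ge0// ltW.
  rewrite absqD absqZ dotcZl exprMn s1.
  move: ei; move: (absq z) (absq w) (dotc z w) (e^-1) => A B C f ef.
  transitivity (f * e * (e / 2 * A + s * C) + f / 2 * B); first by rewrite ef; ring.
  by field.
have := key 1 (expr1n _ _); have : (-1 : R) ^+ 2 = 1 by rewrite sqrrN expr1n.
by move=> /key; rewrite ler_norml => h1 h2; apply/andP; split; lra.
Qed.

Lemma dotc_le z w : `|dotc z w| <= absq z + absq w.
Proof.
have := @dotc_young 1 z w ltr01; rewrite invr1.
by have := absq_ge0 z; have := absq_ge0 w; lra.
Qed.

Lemma absqD_le z w : absq (z + w) <= 2 * absq z + 2 * absq w.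
Proof.
have := dotc_young z w ltr01; rewrite absqD invr1 ler_norml => /andP[_].
by lra.
Qed.

Lemma absq_sum_le (I : Type) (r : seq I) (F : I -> R[i]) :
  absq (\sum_(i <- r) F i) <= 2 ^+ size r * \sum_(i <- r) absq (F i).
Proof.
elim: r => [|i r IH]; first by rewrite !big_nil absq0 mulr0.
rewrite !big_cons /= exprS; apply: le_trans (absqD_le _ _) _.
rewrite -mulrA -mulrDr ler_pM2l// mulrDr lerD//.
by rewrite ler_peMl ?absq_ge0// exprn_ege1// ler1n.
Qed.

Lemma Re_sqr_le z : complex.Re z ^+ 2 <= absq z.
Proof. by rewrite /absq lerDl sqr_ge0. Qed.

Lemma Im_sqr_le z : complex.Im z ^+ 2 <= absq z.
Proof. by rewrite /absq lerDr sqr_ge0. Qed.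

End RealDot.

(** * Square-summable states, shifts, and the bounded skew operator [iA] *)

Section L2.
Variables (R : realType) (d : nat).
Notation state := ('rV[int]_d -> R[i]).
Implicit Types (phi chi : state) (v n : 'rV[int]_d) (a : R).

Definition l2 phi := summ (fun n => absq (phi n)).

Definition rdot phi chi : R := tsum (fun n => dotc (phi n) (chi n)).

Lemma l2normsqE phi : l2normsq phi = rdot phi phi.
Proof. by rewrite /rdot; under eq_fun do rewrite -absqE. Qed.

Lemma in_l2P phi : in_l2 phi -> l2 phi.
Proof. by apply: cvgn_summ => n; exact: absq_ge0. Qed.

Lemma l2_le phi chi a : (forall n, absq (phi n) <= a * absq (chi n)) -> l2 chi -> l2 phi.
Proof.
move=> H /(summZ a); apply: summ_le => n.
by rewrite ger0_norm ?absq_ge0.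
Qed.

Lemma l2D phi chi : l2 phi -> l2 chi -> l2 (fun n => phi n + chi n).
Proof.
move=> h1 h2; apply: summ_le (summD (summZ 2 h1) (summZ 2 h2)) => n.
by rewrite ger0_norm ?absq_ge0// absqD_le.
Qed.

Lemma l2M (c : R[i]) phi : l2 phi -> l2 (fun n => c * phi n).
Proof. by apply: (l2_le (a := absq c)) => n; rewrite absqM. Qed.

Lemma l2N phi : l2 phi -> l2 (fun n => - phi n).
Proof. by apply: (l2_le (a := 1)) => n; rewrite absqN mul1r. Qed.

Lemma l2_shift v phi : l2 phi -> l2 (fun n => phi (n + v)).
Proof. exact: summ_shift. Qed.

Lemma l2_sum (I : Type) (r : seq I) (F : I -> state) : (forall i, l2 (F i)) ->
  l2 (fun n => \sum_(i <- r) F i n).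
Proof.
move=> lF; elim: r => [|i r IH].
  by under eq_fun do rewrite big_nil; rewrite /l2 absq0; exact: summ0.
by under eq_fun do rewrite big_cons; exact: l2D.
Qed.

Lemma l2_Sk k phi : l2 phi -> l2 (Sk k phi).
Proof. by move=> lphi; apply: l2_sum => j; apply: l2D; exact: l2_shift. Qed.

Lemma summ_dotc phi chi : l2 phi -> l2 chi -> summ (fun n => dotc (phi n) (chi n)).
Proof.
by move=> h1 h2; apply: summ_le (summD h1 h2) => n; exact: dotc_le.
Qed.

Lemma rdotC phi chi : rdot phi chi = rdot chi phi.
Proof. by rewrite /rdot; under eq_fun do rewrite dotcC. Qed.

Lemma rdotDl phi phi' chi : l2 phi -> l2 phi' -> l2 chi ->
  rdot (fun n => phi n + phi' n) chi = rdot phi chi + rdot phi' chi.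
Proof.
move=> h1 h2 h3; rewrite -tsumD; try exact: summ_dotc.
by congr tsum; apply/funext => n; rewrite dotcDl.
Qed.

Lemma rdotZl a phi chi : l2 phi -> l2 chi ->
  rdot (fun n => a%:C * phi n) chi = a * rdot phi chi.
Proof.
move=> h1 h2; rewrite -tsumZ; try exact: summ_dotc.
by congr tsum; apply/funext => n; rewrite dotcZl.
Qed.

Lemma rdot_suml (I : Type) (r : seq I) (F : I -> state) chi :
  (forall i, l2 (F i)) -> l2 chi ->
  rdot (fun n => \sum_(i <- r) F i n) chi = \sum_(i <- r) rdot (F i) chi.
Proof.
move=> lF lchi; elim: r => [|i r IH].
  rewrite big_nil -[RHS](@tsum0 R d); congr tsum; apply/funext => n.
  by rewrite big_nil dotc0l.
rewrite big_cons -IH -rdotDl//; last exact: l2_sum.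
by congr tsum; apply/funext => n; rewrite big_cons.
Qed.

Lemma rdot_sumr (I : Type) (r : seq I) (F : I -> state) chi :
  (forall i, l2 (F i)) -> l2 chi ->
  rdot chi (fun n => \sum_(i <- r) F i n) = \sum_(i <- r) rdot chi (F i).
Proof.
move=> lF lchi; rewrite rdotC rdot_suml//.
by apply: eq_bigr => i _; rewrite rdotC.
Qed.

Lemma rdot_iM phi chi : l2 phi -> l2 chi ->
  rdot (fun n => 'i * phi n) chi = - rdot phi (fun n => 'i * chi n).
Proof.
move=> h1 h2; rewrite -mulN1r -tsumZ; last by apply: summ_dotc => //; exact: l2M.
by congr tsum; apply/funext => n; rewrite dotc_iM mulN1r.
Qed.

Lemma rdot_shift v phi chi : l2 phi -> l2 chi ->
  rdot (fun n => phi (n + v)) chi = rdot phi (fun n => chi (n - v)).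
Proof.
move=> h1 h2; rewrite [RHS]/rdot -[RHS](tsum_shift v); last first.
  by apply: summ_dotc => //; exact: l2_shift.
by congr tsum; apply/funext => n; rewrite addrK.
Qed.

(** The two shifts along an axis are adjoint to each other, so taking adjoints only exchanges
    them. *)
Lemma rdot_Sk k phi chi : l2 phi -> l2 chi ->
  rdot (Sk k phi) chi = rdot phi (Sk k chi).
Proof.
move=> h1 h2.
rewrite rdot_suml//; last by move=> j; apply: l2D; exact: l2_shift.
rewrite rdot_sumr//; last by move=> j; apply: l2D; exact: l2_shift.
apply: eq_bigr => j _; rewrite rdotDl//; try exact: l2_shift.
rewrite [RHS]rdotC rdotDl//; try exact: l2_shift.
by rewrite addrC; congr (_ + _); rewrite [RHS]rdotC rdot_shift// opprK.
Qed.

Lemma rdot_ge0 phi : l2 phi -> 0 <= rdot phi phi.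
Proof.
move=> h; apply: tsum_ge0; last exact: summ_dotc.
by move=> n; rewrite -absqE absq_ge0.
Qed.

Lemma rdot_young e phi chi : 0 < e -> l2 phi -> l2 chi ->
  `|rdot phi chi| <= e / 2 * rdot phi phi + e^-1 / 2 * rdot chi chi.
Proof.
move=> e0 h1 h2.
have h11 := summ_dotc h1 h1; have h22 := summ_dotc h2 h2.
have h12 := summ_dotc h1 h2.
rewrite -!tsumZ// -tsumD; try exact: summZ.
have H n := dotc_young (phi n) (chi n) e0.
have hr : summ (fun n => e / 2 * dotc (phi n) (phi n) + e^-1 / 2 * dotc (chi n) (chi n)).
  by apply: summD; exact: summZ.
rewrite ler_norml; apply/andP; split.
  rewrite -mulN1r -tsumZ//; apply: ler_tsum => //; first exact: summZ.
  by move=> n; have := H n; rewrite ler_norml !absqE mulN1r => /andP[].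
by apply: ler_tsum => // n; have := H n; rewrite ler_norml !absqE => /andP[].
Qed.

Lemma absq_le_rdot phi n : l2 phi -> absq (phi n) <= rdot phi phi.
Proof.
move=> h; rewrite -l2normsqE.
exact: (le_tsum (f := fun n => absq (phi n)) n (fun=> absq_ge0 _) h).
Qed.

Lemma rdot_shift2 v phi : l2 phi ->
  rdot (fun n => phi (n + v)) (fun n => phi (n + v)) = rdot phi phi.
Proof.
move=> h; rewrite rdot_shift//; last exact: l2_shift.
by under [fun n => phi (n - v + v)]eq_fun do rewrite subrK.
Qed.

Lemma ler_rdot a phi chi : l2 phi -> l2 chi ->
  (forall n, absq (phi n) <= a * absq (chi n)) -> rdot phi phi <= a * rdot chi chi.
Proof.
move=> h1 h2 H; rewrite -!l2normsqE -[leRHS]tsumZ//.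
by apply: ler_tsum => //; exact: summZ.
Qed.

Lemma rdotD_le phi chi : l2 phi -> l2 chi ->
  rdot (fun n => phi n + chi n) (fun n => phi n + chi n)
  <= 2 * rdot phi phi + 2 * rdot chi chi.
Proof.
move=> h1 h2; rewrite -!l2normsqE -!tsumZ// -tsumD; try exact: summZ.
apply: ler_tsum; [exact: l2D|by apply: summD; exact: summZ|].
by move=> n; exact: absqD_le.
Qed.

(** Any finite bound serves, so the constant is crude. It is written as M^2 so that powers of M
    bound norms, and M is kept away from 0 so that M^k can be a weight in Young's inequality. *)
Lemma rdot_adjA_bounded : exists2 M : R, 1 <= M &
  forall phi, l2 phi -> rdot (adjA phi) (adjA phi) <= M ^+ 2 * rdot phi phi.
Proof.
pose r := index_enum 'I_d; pose C : R := 2 ^+ size r * \sum_(j <- r) 4.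
have C0 : 0 <= C by rewrite mulr_ge0 ?exprn_ge0// sumr_ge0.
exists (1 + C); first by rewrite lerDl.
move=> phi h; apply: (@le_trans _ _ (C * rdot phi phi)); last first.
  apply: ler_wpM2r; first exact: rdot_ge0.
  by rewrite expr2; nra.
pose F j n := phi (n - ebasis j *+ 1) + phi (n + ebasis j *+ 1).
have lF j : l2 (F j) by apply: l2D; exact: l2_shift.
have sF : summ (fun n => \sum_(j <- r) absq (F j n)) by exact: summ_sum.
apply: (@le_trans _ _ (2 ^+ size r * \sum_(j <- r) rdot (F j) (F j))).
  under eq_bigr do rewrite -l2normsqE.
  rewrite -l2normsqE -tsum_sum// -tsumZ//; apply: ler_tsum; first exact: l2_Sk.
    exact: summZ.
  by move=> n; exact: absq_sum_le.
rewrite /C -mulrA; apply: ler_wpM2l; first exact: exprn_ge0.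
rewrite mulr_suml; apply: ler_sum => j _.
apply: (le_trans (rdotD_le _ _)); try exact: l2_shift.
by rewrite !rdot_shift2//; lra.
Qed.

Definition iA phi : state := fun n => 'i * adjA phi n.

Lemma l2_iA phi : l2 phi -> l2 (iA phi).
Proof. by move=> h; apply: l2M; exact: l2_Sk. Qed.

Lemma l2_iter k phi : l2 phi -> l2 (iter k iA phi).
Proof. by move=> h; elim: k => //= k; exact: l2_iA. Qed.

Lemma rdot_iA phi chi : l2 phi -> l2 chi -> rdot (iA phi) chi = - rdot phi (iA chi).
Proof.
move=> h1 h2; rewrite rdot_iM//; last exact: l2_Sk.
rewrite rdot_Sk//; last exact: l2M.
congr (- rdot _ _); apply/funext => n; rewrite /iA /adjA /Sk mulr_sumr.
by apply: eq_bigr => j _; rewrite mulrDr.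
Qed.

(** Each of the k factors moved across costs a sign. Up to that sign the entries depend on k + l
    only, which is what makes the double exponential sum collapse later. *)
Lemma rdot_iter_iA k l phi : l2 phi ->
  rdot (iter k iA phi) (iter l iA phi) = (-1) ^+ k * rdot phi (iter (k + l) iA phi).
Proof.
move=> h; elim: k l => [|k IH] l; first by rewrite mul1r.
rewrite /= rdot_iA; try exact: l2_iter.
by rewrite -[iA (iter l _ _)]/(iter l.+1 iA phi) IH addnS exprS mulN1r mulNr.
Qed.

Lemma rdot_iter_bounded : exists2 M : R, 0 <= M &
  forall k phi, l2 phi -> rdot (iter k iA phi) (iter k iA phi) <= (M ^+ k) ^+ 2 * rdot phi phi
   /\ `|rdot phi (iter k iA phi)| <= M ^+ k * rdot phi phi.
Proof.
have [M M1 HM] := rdot_adjA_bounded; have M0 : 0 < M by lra.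
exists M; first exact: ltW.
have key k phi : l2 phi ->
    rdot (iter k iA phi) (iter k iA phi) <= (M ^+ k) ^+ 2 * rdot phi phi.
  move=> h; elim: k => [|k IH]; first by rewrite expr0 expr1n mul1r.
  have lk := l2_iter k h.
  apply: (@le_trans _ _ (rdot (adjA (iter k iA phi)) (adjA (iter k iA phi)))).
    rewrite -[leRHS]mul1r; apply: ler_rdot => [||n].
    - exact: (l2_iter k.+1).
    - exact: l2_Sk.
    - by rewrite absq_iM mul1r.
  apply: le_trans (HM _ lk) _.
  by rewrite (exprS M k) exprMn -[leRHS]mulrA; apply: ler_wpM2l; first exact: sqr_ge0.
move=> k phi h; split; first exact: key.
(* The weight M^k balances the two halves of Young's inequality, so nothing is lost compared with
   Cauchy-Schwarz. *)
have e0 : 0 < M ^+ k by rewrite exprn_gt0.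
apply: (le_trans (rdot_young e0 h (l2_iter k h))).
have : (M ^+ k)^-1 / 2 * rdot (iter k iA phi) (iter k iA phi) <=
  (M ^+ k)^-1 / 2 * ((M ^+ k) ^+ 2 * rdot phi phi).
  by apply: ler_wpM2l; [rewrite divr_ge0// invr_ge0 ltW|exact: key].
rewrite (_ : _ / 2 * (_ * _) = M ^+ k / 2 * rdot phi phi); first by lra.
by field; rewrite expf_neq0 ?gt_eqF.
Qed.

(** The index list is arbitrary so that the formula covers both the partial sums of the exponential
    and the blocks between two of them. *)
Lemma rdot_sum_iter (r : seq nat) (c : nat -> R) phi : l2 phi ->
  let F := fun n => \sum_(k <- r) (c k)%:C * iter k iA phi n in
  rdot F F = \sum_(k <- r) \sum_(l <- r)
               c k * c l * (-1) ^+ k * rdot phi (iter (k + l) iA phi).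
Proof.
move=> h; have lc k : l2 (fun n => (c k)%:C * iter k iA phi n).
  by apply: l2M; exact: l2_iter.
rewrite /= rdot_suml//; last exact: l2_sum.
apply: eq_bigr => k _; rewrite rdot_sumr//; apply: eq_bigr => l _.
rewrite rdotZl//; last exact: l2_iter.
rewrite rdotC rdotZl; try exact: l2_iter.
by rewrite rdotC rdot_iter_iA//; ring.
Qed.

End L2.

(** * Exponential sums *)

Section ExpSums.
Variable R : realType.
Implicit Types (x y t : R) (K N : nat).

Lemma cvg_bounded_by (u b : nat -> R) (l : R) :
  (forall K, `|u K - l| <= b K) -> b K @[K --> \oo] --> 0 ->
  u K @[K --> \oo] --> l.
Proof.
move=> ub b0; apply: (squeeze_cvgr (f := fun K => l - b K) (h := fun K => l + b K)).
- by apply: nearW => K; have := ub K; rewrite ler_distl.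
- by rewrite -[X in _ --> X]subr0; apply: cvgB => //; exact: cvg_cst.
- by rewrite -[X in _ --> X]addr0; apply: cvgD => //; exact: cvg_cst.
Qed.

Definition psum_exp x K : R := \sum_(k < K) x ^+ k / k`!%:R.

Lemma psum_exp_cvg x : psum_exp x K @[K --> \oo] --> expR x.
Proof.
have E : series (exp_coeff x) = psum_exp x.
  by apply/funext => K; rewrite seriesEord.
by have := is_cvg_series_exp_coeff x; rewrite /expR E.
Qed.

Lemma psum_exp_le x K L : 0 <= x -> (K <= L)%N -> psum_exp x K <= psum_exp x L.
Proof.
move=> x0 KL; rewrite /psum_exp -!(big_mkord xpredT (fun k => x ^+ k / k`!%:R)).
rewrite [leRHS](big_cat_nat _ KL)//= lerDl; apply: sumr_ge0 => k _.
by rewrite divr_ge0// exprn_ge0.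
Qed.

Lemma psum_exp_le_expR x K : 0 <= x -> psum_exp x K <= expR x.
Proof.
move=> x0; rewrite -(cvg_lim _ (@psum_exp_cvg x))//.
apply: (nondecreasing_cvgn_le (u_ := psum_exp x)).
  by move=> ? ?; exact: psum_exp_le.
by apply/cvg_ex; exists (expR x); exact: psum_exp_cvg.
Qed.

Lemma sum_triangle (a : nat -> nat -> R) K :
  \sum_(k < K) \sum_(0 <= l < K - k) a k l =
  \sum_(N < K) \sum_(k < N.+1) a k (N - k)%N.
Proof.
elim: K => [|K IH]; first by rewrite !big_ord0.
rewrite [RHS]big_ord_recr -IH /= [X in _ = _ + X]big_ord_recr /= addrA.
rewrite big_ord_recr /= subSnn subnn big_nat1 -big_split /=.
congr (_ + _); apply: eq_bigr => k _.
by rewrite subSn 1?ltnW// big_nat_recr.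
Qed.

Lemma sum_exp_binomial x y N :
  \sum_(k < N.+1) x ^+ k / k`!%:R * (y ^+ (N - k) / (N - k)`!%:R)
  = (x + y) ^+ N / N`!%:R.
Proof.
rewrite addrC exprDn mulr_suml; apply: eq_bigr => k _.
have kN : (k <= N)%N by rewrite -ltnS.
have f0 (n : nat) : n`!%:R != 0 :> R by rewrite pnatr_eq0 -lt0n fact_gt0.
rewrite -mulr_natr -(bin_fact kN) !natrM; field.
by rewrite !f0 pnatr_eq0 -lt0n bin_gt0 kN.
Qed.

(* A square partial sum of a double series dominated by the product of two
   exponential series differs from the triangular one by at most
   [Q * (E_K x ^ 2 - E_K (2 x))], which tends to 0 because
   [exp (2 x) = exp x ^ 2]. *)
Lemma square_sum_cvg (a : nat -> nat -> R) x (Q l : R) : 0 <= x ->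
  (forall k l, `|a k l| <= Q * (x ^+ k / k`!%:R * (x ^+ l / l`!%:R))) ->
  \sum_(N < K) \sum_(k < N.+1) a k (N - k)%N @[K --> \oo] --> l ->
  \sum_(k < K) \sum_(l < K) a k l @[K --> \oo] --> l.
Proof.
move=> x0 aQ tri.
pose sq (b : nat -> nat -> R) K := \sum_(k < K) \sum_(l < K) b k l.
pose tr (b : nat -> nat -> R) K := \sum_(N < K) \sum_(k < N.+1) b k (N - k)%N.
pose rest (b : nat -> nat -> R) K :=
  \sum_(k < K) \sum_(K - k <= l < K) b k l.
pose e k l := x ^+ k / k`!%:R * (x ^+ l / l`!%:R).
have split b K : sq b K = tr b K + rest b K.
  rewrite /tr -sum_triangle -big_split /=; apply: eq_bigr => k _.
  by rewrite -big_cat_nat ?leq_subr//= big_mkord.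
have restE K : rest e K = psum_exp x K ^+ 2 - psum_exp (x + x) K.
  rewrite (_ : psum_exp (x + x) K = tr e K).
    rewrite (_ : psum_exp x K ^+ 2 = sq e K); first by rewrite split; ring.
    by rewrite expr2 /psum_exp big_distrlr.
  by apply: eq_bigr => N _; rewrite sum_exp_binomial.
have rest0 : rest a K @[K --> \oo] --> 0.
  have B K : `|rest a K| <= Q * rest e K.
    rewrite mulr_sumr; apply: le_trans (ler_norm_sum _ _ _) _.
    apply: ler_sum => k _; rewrite mulr_sumr; apply: le_trans (ler_norm_sum _ _ _) _.
    by apply: ler_sum => ? _; exact: aQ.
  have C : Q * rest e K @[K --> \oo] --> 0.
    rewrite -(mulr0 Q) -(subrr (expR x ^+ 2)) {2}expr2 -expRD.
    apply: cvgMr; rewrite (funext restE).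
    by apply: cvgB; [apply: cvgM; exact: psum_exp_cvg|exact: psum_exp_cvg].
  by apply: (cvg_bounded_by _ C) => K; rewrite subr0.
rewrite -(addr0 l); under eq_fun do rewrite -[\sum_(_ < _) _]/(sq a _) split.
exact: cvgD tri rest0.
Qed.

Lemma cvg_complex (u : nat -> R[i]) (l : R[i]) :
  complex.Re (u N) @[N --> \oo] --> complex.Re l ->
  complex.Im (u N) @[N --> \oo] --> complex.Im l ->
  (u : nat -> (R[i])^o) N @[N --> \oo] --> (l : (R[i])^o).
Proof.
move=> /cvgrPdist_lt cRe /cvgrPdist_lt cIm; apply/cvgrPdist_lt => e e0.
(* The radius is an element of [R[i]]; being positive there forces its imaginary part to vanish. *)
have [r r0 ->] : exists2 r : R, 0 < r & e = r%:C.
  by case: e e0 => a b; rewrite ltcE /= => /andP[/eqP -> a0]; exists a.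
have r2 : 0 < r / 2 by rewrite divr_gt0.
near=> N.
have hRe : `|complex.Re l - complex.Re (u N)| < r / 2 by near: N; exact: cRe.
have hIm : `|complex.Im l - complex.Im (u N)| < r / 2 by near: N; exact: cIm.
have -> : l - u N = (complex.Re l - complex.Re (u N)) +i*
    (complex.Im l - complex.Im (u N)) by case: (l) (u N) => [? ?] [? ?].
rewrite normc_def ltcR /= -(ger0_norm (ltW r0)) -sqrtr_sqr ltr_sqrt ?exprn_gt0//.
have sq (a : R) : `|a| < r / 2 -> a ^+ 2 < (r / 2) ^+ 2.
  by move=> ar; rewrite -(real_normK (num_real a)) ltrXn2r ?nnegrE// ltW.
by have := sq _ hRe; have := sq _ hIm; nra.
Unshelve. all: by end_near. Qed.

End ExpSums.

Section Expit.
Variables (R : realType) (d : nat).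
Notation state := ('rV[int]_d -> R[i]).
Implicit Types (phi chi : state) (n : 'rV[int]_d) (t : R) (j : 'I_d).

(** The powers of 'i are absorbed into [iA], so the coefficients are real and can be pulled out of
    the real form [rdot]. *)
Definition expsum t phi K : state :=
  fun n => \sum_(k < K) (t ^+ k / k`!%:R)%:C * iter k (@iA R d) phi n.

Lemma adjAM (c : R[i]) phi : adjA (fun n => c * phi n) = fun n => c * adjA phi n.
Proof.
apply/funext => n; rewrite /adjA /Sk mulr_sumr.
by apply: eq_bigr => j _; rewrite mulrDr.
Qed.

Lemma iter_iA k phi n : iter k (@iA R d) phi n = 'i ^+ k * iter k (@adjA R d) phi n.
Proof.
elim: k n => [|k IH] n; first by rewrite mul1r.
rewrite /= (_ : iter k _ phi = fun n => 'i ^+ k * iter k (@adjA R d) phi n).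
  by rewrite /iA adjAM exprS mulrA.
by apply/funext => m; exact: IH.
Qed.

Lemma expitAE t phi n :
  expitA t phi n = limn ((fun K => expsum t phi K n) : nat -> (R[i])^o).
Proof.
apply: (congr1 (fun f : nat -> (R[i])^o => limn f)); apply/funext => K; apply: eq_bigr => k _.
by rewrite iter_iA rmorphM fmorphV rmorphXn rmorph_nat exprMn; ring.
Qed.

(** A coordinate is bounded by the l^2 norm, so the k-th term is at most a constant times (|t| M)^k
    / k!. The constant 1 + |phi|^2 bounds the norm of phi without a square root. *)
Lemma expsum_pointwise t phi n : l2 phi -> exists z : R[i],
  complex.Re (expsum t phi K n) @[K --> \oo] --> complex.Re z /\
  complex.Im (expsum t phi K n) @[K --> \oo] --> complex.Im z.
Proof.
move=> h; have [M M0 HM] := rdot_iter_bounded R d.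
pose Q := 1 + rdot phi phi; have q0 := rdot_ge0 h.
have Q1 : 1 <= Q by rewrite lerDl.
(* Here g is the real or the imaginary part; both need the same argument. *)
have conv (g : R[i] -> R) : (forall a z, g (a%:C * z) = a * g z) ->
    {morph g : x y / x + y} -> (forall z, g z ^+ 2 <= absq z) ->
    cvgn (fun K => g (expsum t phi K n)).
  move=> gZ gD gle; have g0 : g 0 = 0 by rewrite -(mul0r 0) gZ mul0r.
  pose u := fun k => t ^+ k / k`!%:R * g (iter k (@iA R d) phi n).
  rewrite (_ : (fun _ => _) = series u); last first.
    apply/funext => K; rewrite seriesEord /= /expsum (big_morph g gD g0).
    by apply: eq_bigr => k _; rewrite gZ.
  apply: normed_cvg.
  pose v := Q *: exp_coeff (`|t| * M).
  have v0 k : 0 <= v k by rewrite mulr_ge0// ?divr_ge0 ?exprn_ge0 ?mulr_ge0//; lra.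
  apply: (@series_le_cvg _ _ v); [by move=> k; exact: normr_ge0|exact: v0|move=> k|]; last first.
    by apply: is_cvg_seriesZ; exact: is_cvg_series_exp_coeff.
  change (`|u k| <= Q * (((`|t| * M) ^+ k) / k`!%:R)).
  rewrite /u normrM normrM normfV normrX [`|_%:R|]ger0_norm//.
  have gb : `|g (iter k (@iA R d) phi n)| <= M ^+ k * Q.
    rewrite -ler_sqr ?nnegrE ?mulr_ge0 ?exprn_ge0//; last by lra.
    rewrite real_normK ?num_real//; apply: (le_trans (gle _)).
    apply: (le_trans (absq_le_rdot _ (l2_iter k h))).
    apply: (le_trans (HM k _ h).1); rewrite exprMn; apply: ler_wpM2l.
      exact: sqr_ge0.
    by rewrite /Q; nra.
  apply: (le_trans (ler_wpM2l _ gb)); first by rewrite divr_ge0// exprn_ge0.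
  by rewrite exprMn (_ : Q * _ = `|t| ^+ k / k`!%:R * (M ^+ k * Q))//; ring.
have cRe : cvgn (fun K => complex.Re (expsum t phi K n)).
  apply: conv => [a z|z w|z]; last exact: Re_sqr_le.
    by case: z => ? ? /=; ring.
  by case: z w => ? ? [].
have cIm : cvgn (fun K => complex.Im (expsum t phi K n)).
  apply: conv => [a z|z w|z]; last exact: Im_sqr_le.
    by case: z => ? ? /=; ring.
  by case: z w => ? ? [].
by exists (limn (fun K => complex.Re (expsum t phi K n)) +i*
           limn (fun K => complex.Im (expsum t phi K n))).
Qed.

Lemma expitA_cvg_parts t phi n : l2 phi ->
  complex.Re (expsum t phi K n) @[K --> \oo] --> complex.Re (expitA t phi n) /\
  complex.Im (expsum t phi K n) @[K --> \oo] --> complex.Im (expitA t phi n).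
Proof.
move=> h; have [z [zRe zIm]] := expsum_pointwise t n h.
rewrite (_ : expitA t phi n = z)// expitAE.
apply: (@cvg_lim (R[i])^o); last exact: (cvg_complex zRe zIm).
exact: norm_hausdorff.
Qed.

Lemma expitA_cvg t phi n : l2 phi ->
  ((fun K => expsum t phi K n) : nat -> (R[i])^o) K @[K --> \oo] -->
  (expitA t phi n : (R[i])^o).
Proof. by move=> /(expitA_cvg_parts t n)[? ?]; exact: cvg_complex. Qed.

End Expit.

(** * Unitarity of the propagator *)

Section Unitarity.
Variables (R : realType) (d : nat).
Notation state := ('rV[int]_d -> R[i]).
Implicit Types (phi chi : state) (n : 'rV[int]_d) (t : R) (j : 'I_d).

Lemma l2_expsum t phi K : l2 phi -> l2 (expsum t phi K).
Proof.
by move=> h; apply: l2_sum => k; apply: l2M; exact: l2_iter.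
Qed.

(** The square sums of the double series have the same limit as the triangular ones, and the latter
    are constant by the binomial theorem. *)
Lemma rdot_expsum_cvg t phi : l2 phi ->
  rdot (expsum t phi K) (expsum t phi K) @[K --> \oo] --> rdot phi phi.
Proof.
move=> h; have [M M0 HM] := rdot_iter_bounded R d.
pose B k := rdot phi (iter k (@iA R d) phi).
pose a k l : R := t ^+ k / k`!%:R * (t ^+ l / l`!%:R) * (-1) ^+ k * B (k + l)%N.
rewrite (_ : (fun K => _) = fun K => \sum_(k < K) \sum_(l < K) a k l); last first.
  apply/funext => K; have := rdot_sum_iter (index_iota 0 K) (fun k => t ^+ k / k`!%:R) h.
  rewrite /= (_ : (fun n => _) = expsum t phi K) => [->|].
    by rewrite big_mkord; apply: eq_bigr => k _; rewrite big_mkord.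
  by apply/funext => n; rewrite big_mkord.
apply: (@square_sum_cvg _ _ (`|t| * M) (rdot phi phi)).
- exact: mulr_ge0.
- move=> k l; rewrite /a !normrM !normrV ?unitfE ?pnatr_eq0 -?lt0n ?fact_gt0//.
  rewrite !normrX normrN1 expr1n mulr1 [`|k`!%:R|]ger0_norm// [`|l`!%:R|]ger0_norm//.
  have HB : `|B (k + l)%N| <= M ^+ (k + l) * rdot phi phi by exact: (HM _ _ h).2.
  apply: (le_trans (ler_wpM2l _ HB)).
    by rewrite mulr_ge0// divr_ge0// exprn_ge0.
  rewrite exprD !exprMn le_eqVlt; apply/orP; left; apply/eqP; ring.
(* The antidiagonal N contributes (-t + t)^N / N! times B(N), so only N = 0 survives. The empty sum
   at K = 0 is the one exception to constancy. *)
- apply: cvg_near_cst; exists 1%N => // -[//|K] _.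
  rewrite big_ord_recl /= big_ord_recl big_ord0 /a /= !fact0 /B /=.
  rewrite big1 ?addr0; first by rewrite !expr0; field.
  move=> N _; rewrite (eq_bigr (fun k : 'I_(bump 0 N).+1 =>
    (- t) ^+ k / k`!%:R * (t ^+ (bump 0 N - k) / (bump 0 N - k)`!%:R) * B (bump 0 N))).
    by rewrite -mulr_suml sum_exp_binomial addNr exprS !mul0r.
  move=> k _; rewrite subnKC; last by rewrite -ltnS.
  by rewrite (exprNn t) /B; ring.
Qed.

(** The bound does not involve L, so it survives the pointwise limit in L. *)
Lemma rdot_expsumB_le t phi : l2 phi -> exists2 x : R, 0 <= x &
  forall K L, (K <= L)%N ->
    let F := fun n => expsum t phi L n - expsum t phi K n in
    rdot F F <= (expR x - psum_exp x K) ^+ 2 * rdot phi phi.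
Proof.
move=> h; have [M M0 HM] := rdot_iter_bounded R d.
exists (`|t| * M); first exact: mulr_ge0.
set x := `|t| * M; have x0 : 0 <= x by exact: mulr_ge0.
move=> K L KL /=; have := rdot_sum_iter (index_iota K L) (fun k => t ^+ k / k`!%:R) h.
rewrite /= (_ : (fun n => _) = fun n => expsum t phi L n - expsum t phi K n); last first.
  apply/funext => n; rewrite /expsum -!(big_mkord xpredT
    (fun k => (t ^+ k / k`!%:R)%:C * iter k (@iA R d) phi n)).
  by rewrite [X in X - _](big_cat_nat (leq0n _) KL)/= [RHS]addrC addKr.
move=> ->; pose S := \sum_(K <= k < L) x ^+ k / k`!%:R.
have q0 := rdot_ge0 h.
apply: (@le_trans _ _ (S ^+ 2 * rdot phi phi)); last first.
  apply: ler_wpM2r => //.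
  have SE : psum_exp x L = psum_exp x K + S.
    by rewrite /psum_exp /S -!(big_mkord xpredT (fun k => x ^+ k / k`!%:R))
      (big_cat_nat _ KL).
  have S0 : 0 <= S by apply: sumr_ge0 => k _; rewrite divr_ge0// exprn_ge0.
  have SL : S <= expR x - psum_exp x K.
    by have := psum_exp_le_expR L x0; rewrite SE; lra.
  by rewrite ler_sqr ?nnegrE//; lra.
rewrite expr2 {1}/S -mulrA mulr_suml; apply: ler_sum => k _.
rewrite mulrCA /S mulr_suml; apply: ler_sum => l _.
have HB := (HM (k + l)%N phi h).2.
apply: (le_trans (ler_norm _)); rewrite !normrM !normrV ?unitfE ?pnatr_eq0 -?lt0n ?fact_gt0//.
rewrite !normrX normrN1 expr1n mulr1 [`|k`!%:R|]ger0_norm// [`|l`!%:R|]ger0_norm//.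
apply: (le_trans (ler_wpM2l _ HB)).
  by rewrite mulr_ge0// divr_ge0// exprn_ge0.
by rewrite /x exprD !exprMn le_eqVlt; apply/orP; left; apply/eqP; ring.
Qed.

Lemma boxsum_absq_cvg (f : nat -> state) phi N :
  (forall n, complex.Re (f K n) @[K --> \oo] --> complex.Re (phi n)) ->
  (forall n, complex.Im (f K n) @[K --> \oo] --> complex.Im (phi n)) ->
  boxsum N (fun n => absq (f K n)) @[K --> \oo] --> boxsum N (fun n => absq (phi n)).
Proof.
move=> fRe fIm; apply: cvg_big => [|x _]; [exact: add_continuous|rewrite /absq].
by apply: cvgD; rewrite expr2; under eq_fun do rewrite expr2; exact: cvgM.
Qed.

(* Fatou: boxes are finite, so bounds on box sums pass to pointwise limits. *)
Lemma boxsum_absq_le_lim (f : nat -> state) phi N (C : R) K0 :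
  (forall n, complex.Re (f K n) @[K --> \oo] --> complex.Re (phi n)) ->
  (forall n, complex.Im (f K n) @[K --> \oo] --> complex.Im (phi n)) ->
  (forall K, (K0 <= K)%N -> l2 (f K) /\ rdot (f K) (f K) <= C) ->
  boxsum N (fun n => absq (phi n)) <= C.
Proof.
move=> fRe fIm fC; have c := boxsum_absq_cvg (N := N) fRe fIm.
rewrite -(cvg_lim _ c)//; apply: limr_le; first by apply/cvg_ex; eexists; exact: c.
exists K0 => // K /= /fC[lK KC]; apply: le_trans KC; rewrite -l2normsqE.
by apply: (boxsum_le_tsum (f := fun n => absq (f K n))) => // n; exact: absq_ge0.
Qed.

(** Letting L tend to infinity on each box in the block estimate gives convergence in norm, and its
    case K = 0 gives square summability of the limit. *)
Lemma expitA_l2_rdotB t phi : l2 phi -> l2 (expitA t phi) /\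
  exists2 x : R, 0 <= x & forall K,
    let F := fun n => expsum t phi K n - expitA t phi n in
    rdot F F <= (expR x - psum_exp x K) ^+ 2 * rdot phi phi.
Proof.
move=> h; have [x x0 Hx] := rdot_expsumB_le t h.
pose F K n := expitA t phi n - expsum t phi K n.
have FC K N : boxsum N (fun n => absq (F K n))
    <= (expR x - psum_exp x K) ^+ 2 * rdot phi phi.
  apply: (@boxsum_absq_le_lim (fun L n => expsum t phi L n - expsum t phi K n) _ _ _ K).
  - move=> n; under eq_fun do rewrite ReB.
    rewrite /F ReB; apply: cvgB; last exact: cvg_cst.
    exact: (expitA_cvg_parts t n h).1.
  - move=> n; under eq_fun do rewrite ImB.
    rewrite /F ImB; apply: cvgB; last exact: cvg_cst.
    exact: (expitA_cvg_parts t n h).2.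
  - move=> L KL; split; last exact: Hx.
    by apply: l2D; [exact: l2_expsum|apply: l2N; exact: l2_expsum].
have lF K : l2 (F K).
  exists ((expR x - psum_exp x K) ^+ 2 * rdot phi phi) => N.
  by under eq_fun do rewrite ger0_norm ?absq_ge0//; exact: FC.
split.
  rewrite (_ : expitA t phi = fun n => F 0%N n + expsum t phi 0 n).
    by apply: l2D => //; exact: l2_expsum.
  by apply/funext => n; rewrite /F subrK.
exists x => // K /=.
rewrite (_ : (fun n => _) = fun n => (-1)%:C * F K n); last first.
  by apply/funext => n; rewrite /F rmorphN1 mulN1r opprB.
rewrite rdotZl//; last exact: l2M.
rewrite rdotC rdotZl// mulN1r mulN1r opprK -l2normsqE.
exact: tsum_le_ub (lF K) (FC K).
Qed.

Lemma l2_expitA t phi : l2 phi -> l2 (expitA t phi).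
Proof. by move=> /(expitA_l2_rdotB t)[]. Qed.

Lemma rdotD phi chi : l2 phi -> l2 chi ->
  rdot (fun n => phi n + chi n) (fun n => phi n + chi n) =
  rdot phi phi + rdot chi chi + 2 * rdot phi chi.
Proof.
move=> h1 h2; rewrite rdotDl ?(rdotC _ (fun n => _ + _))//; try exact: l2D.
by rewrite !rdotDl// (rdotC chi phi); ring.
Qed.

(** The squared norms of the partial sums tend to |phi|^2, and by convergence in norm also to the
    squared norm of the limit. *)
Lemma rdot_expitA t phi : l2 phi ->
  rdot (expitA t phi) (expitA t phi) = rdot phi phi.
Proof.
move=> h; have [lU [x x0 Hx]] := expitA_l2_rdotB t h.
set U := expitA t phi in lU Hx *.
apply/esym; rewrite -(cvg_lim _ (@rdot_expsum_cvg t phi h))//; apply: cvg_lim => //.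
(* The tail of the exponential may vanish (when x = 0); the added harmonic term makes e K positive,
   hence usable as a weight in Young's inequality. *)
pose e K := expR x - psum_exp x K + K.+1%:R^-1.
have e0 : e K @[K --> \oo] --> 0.
  rewrite -(addr0 0); apply: cvgD; last exact: cvg_harmonic.
  by rewrite -(subrr (expR x)); apply: cvgB; [exact: cvg_cst|exact: psum_exp_cvg].
have egt K : 0 < e K.
  have : 0 < K.+1%:R^-1 :> R by rewrite invr_gt0.
  by have := psum_exp_le_expR K x0; rewrite /e; move: (K.+1%:R^-1) => r *; lra.
pose V K n := expsum t phi K n - U n.
have lV K : l2 (V K) by apply: l2D; [exact: l2_expsum|exact: l2N].
have VE K : rdot (V K) (V K) <= e K ^+ 2 * rdot phi phi.
  apply: (le_trans (Hx K)); apply: ler_wpM2r; first exact: rdot_ge0.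
  have i0 : 0 < K.+1%:R^-1 :> R by rewrite invr_gt0.
  rewrite ler_sqr ?nnegrE ?(ltW (egt K))//; last by have := psum_exp_le_expR K x0; lra.
  by move: i0; rewrite /e; move: (K.+1%:R^-1) => r r0; lra.
pose b K := e K * e K * rdot phi phi + e K * (rdot U U + rdot phi phi).
apply: (cvg_bounded_by (b := b)); last first.
  have {1}-> : 0 = 0 * 0 * rdot phi phi + 0 * (rdot U U + rdot phi phi) :> R by ring.
  by apply: cvgD; apply: cvgM; [exact: cvgM|exact: cvg_cst|exact: e0|exact: cvg_cst].
move=> K.
rewrite (_ : expsum t phi K = fun n => U n + V K n); last first.
  by apply/funext => n; rewrite /V addrC subrK.
rewrite rdotD// (_ : _ - _ = rdot (V K) (V K) + 2 * rdot U (V K)); last by ring.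
have v0 := rdot_ge0 (lV K).
apply: (le_trans (ler_normD _ _)); rewrite (ger0_norm v0) normrM ger0_norm//.
have Y := rdot_young (egt K) lU (lV K).
have Z : (e K)^-1 / 2 * rdot (V K) (V K) <= e K / 2 * rdot phi phi.
  apply: (@le_trans _ _ ((e K)^-1 / 2 * (e K ^+ 2 * rdot phi phi))).
    by apply: ler_wpM2l => //; rewrite divr_ge0// invr_ge0 ltW.
  rewrite le_eqVlt; apply/orP; left; apply/eqP; field.
  by rewrite gt_eqF.
have := VE K; rewrite expr2 /b; move: Y Z.
by move: (rdot U U) (rdot phi phi) (rdot (V K) (V K)) (e K * e K * _) => *; lra.
Qed.

End Unitarity.

(** * Heisenberg evolution of the position *)

Section Heisenberg.
Variables (R : realType) (d : nat).
Notation state := ('rV[int]_d -> R[i]).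
Implicit Types (phi chi : state) (n v : 'rV[int]_d) (t s : R) (j : 'I_d).

Definition axis_coord j n : R := (n 0 j)%:~R.

Definition mulx j phi : state := fun n => (axis_coord j n)%:C * phi n.

(** In Fourier variables this is multiplication by 2 sin(k_j), which explains both the norm bound 2
    and the injectivity on l^2. *)
Definition iD j phi : state :=
  fun n => 'i * (phi (n - ebasis j) - phi (n + ebasis j)).

Lemma axis_coordD j n v : axis_coord j (n + v) = axis_coord j n + axis_coord j v.
Proof. by rewrite /axis_coord mxE intrD. Qed.

Lemma axis_coordN j n : axis_coord j (- n) = - axis_coord j n.
Proof. by rewrite /axis_coord mxE mulrNz. Qed.

Lemma axis_coord_ebasis j k : axis_coord j (ebasis k) = (k == j)%:R.
Proof. by rewrite /axis_coord mxE eqxx /= eq_sym; case: eqP. Qed.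

Lemma iAD phi chi : iA (fun n => phi n + chi n) = fun n => iA phi n + iA chi n.
Proof.
apply/funext => n; rewrite /iA -mulrDr -big_split /=; congr (_ * _).
by apply: eq_bigr => j _; rewrite addrACA.
Qed.

Lemma iAM (c : R[i]) phi : iA (fun n => c * phi n) = fun n => c * iA phi n.
Proof. by apply/funext => n; rewrite /iA adjAM mulrCA. Qed.

Lemma iA_shift v phi : iA (fun n => phi (n + v)) = fun n => iA phi (n + v).
Proof.
apply/funext => n; rewrite /iA; congr (_ * _).
by apply: eq_bigr => j _; rewrite ![n + v + _]addrAC.
Qed.

Lemma iA_iD j phi : iA (iD j phi) = iD j (iA phi).
Proof.
have -> : iD j phi = fun n => 'i * phi (n + - ebasis j) + (- 'i) * phi (n + ebasis j).
  by apply/funext => n; rewrite /iD mulrBr mulNr.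
rewrite iAD !iAM !iA_shift; apply/funext => n.
by rewrite /iD mulrBr mulNr.
Qed.

(** A unit shift along axis k changes the j-th coordinate by one if k = j and not at all otherwise,
    so the commutator keeps only the two shifts along axis j. *)
Lemma mulx_iA j phi : mulx j (iA phi) = fun n => iA (mulx j phi) n + iD j phi n.
Proof.
apply/funext => n; rewrite /mulx /iA /iD /adjA /Sk mulrCA -mulrDr.
congr ('i * _); rewrite mulr_sumr.
rewrite [X in _ + X](_ : _ = \sum_k (k == j)%:R *
    (phi (n - ebasis k *+ 1) - phi (n + ebasis k *+ 1))); last first.
  rewrite (bigD1 j)//= eqxx mul1r big1 ?addr0// => k /negPf ->.
  by rewrite mul0r.
rewrite -big_split /=; apply: eq_bigr => k _; rewrite !mulr1n.
rewrite !axis_coordD axis_coordN axis_coord_ebasis !rmorphD rmorphN rmorph_nat.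
ring.
Qed.

(** As [iD] commutes with [iA], the commutator with a power obeys the rule for differentiating a
    power. *)
Lemma mulx_iter j k phi : mulx j (iter k.+1 (@iA R d) phi) =
  fun n => iter k.+1 (@iA R d) (mulx j phi) n + k.+1%:R * iter k (@iA R d) (iD j phi) n.
Proof.
have iter_iD i : iter i (@iA R d) (iD j phi) = iD j (iter i (@iA R d) phi).
  by elim: i => //= i ->; rewrite iA_iD.
elim: k => [|k IH].
  by rewrite [LHS]mulx_iA; apply/funext => n; rewrite mul1r.
rewrite [LHS]mulx_iA IH iAD iAM; apply/funext => n.
by rewrite -(iter_iD k.+1) /= [k.+2%:R]mulrSr mulrDl mul1r addrA.
Qed.

(** Since (k + 1) t^(k+1) / (k+1)! = t t^k / k!, the commutator part is again an exponential sum,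
    one term shorter. *)
Lemma expsum_mulx j t phi K n :
  mulx j (expsum t phi K.+1) n =
  expsum t (mulx j phi) K.+1 n + t%:C * expsum t (iD j phi) K n.
Proof.
rewrite {1}/mulx /expsum mulr_sumr !big_ord_recl mulr_sumr -addrA; congr (_ + _).
  by rewrite mulrCA.
rewrite -big_split; apply: eq_bigr => k _; rewrite !lift0 [LHS]mulrCA.
rewrite -[(axis_coord j n)%:C * _]/(mulx j (iter k.+1 (@iA R d) phi) n) mulx_iter mulrDr.
congr (_ + _); rewrite !mulrA; congr (_ * _).
rewrite -(rmorph_nat (real_complex R)) -!rmorphM; congr (_%:C).
rewrite exprS factS natrM; field.
by rewrite ?nat1r ?natr1 !pnatr_eq0 -!lt0n fact_gt0.
Qed.

Lemma expitA_unique t phi n (z : R[i]) : l2 phi ->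
  ((fun K => expsum t phi K n) : nat -> (R[i])^o) K @[K --> \oo] --> (z : (R[i])^o) ->
  expitA t phi n = z.
Proof. by move=> h c; rewrite expitAE; apply: (@cvg_lim (R[i])^o) c; exact: norm_hausdorff. Qed.

Lemma expitA_linear t (c : R[i]) phi chi n : l2 phi -> l2 chi ->
  expitA t (fun n => c * phi n + chi n) n = c * expitA t phi n + expitA t chi n.
Proof.
move=> h1 h2; apply: expitA_unique; first by apply: l2D => //; exact: l2M.
have E K : expsum t (fun n => c * phi n + chi n) K n =
    c * expsum t phi K n + expsum t chi K n.
  rewrite /expsum mulr_sumr -big_split /=; apply: eq_bigr => k _.
  rewrite (_ : iter k _ _ = fun n => c * iter k (@iA R d) phi n + iter k (@iA R d) chi n).
    by rewrite mulrDr mulrCA.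
  by elim: (k : nat) => //= i ->; rewrite iAD iAM.
under eq_fun do rewrite E.
apply: (@cvgD _ (R[i])^o); last exact: expitA_cvg.
by apply: (@cvgMr _ _ _ _ (fun K => expsum t phi K n : (R[i])^o)); exact: expitA_cvg.
Qed.

Lemma l2_iD j phi : l2 phi -> l2 (iD j phi).
Proof.
by move=> h; apply: l2M; apply: l2D; [|apply: l2N]; exact: l2_shift.
Qed.

Lemma expitA_mulx j t phi n : l2 phi -> l2 (mulx j phi) ->
  mulx j (expitA t phi) n = expitA t (mulx j phi) n + t%:C * expitA t (iD j phi) n.
Proof.
move=> h1 h2; have h3 := l2_iD j h1.
have c1 := @expitA_cvg R d t _ n h1; have c2 := @expitA_cvg R d t _ n h2; have c3 := @expitA_cvg R d t _ n h3.
have l1 : ((fun K => mulx j (expsum t phi K.+1) n) : nat -> (R[i])^o) K @[K --> \oo]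
    --> (mulx j (expitA t phi) n : (R[i])^o).
  apply: (@cvgMr _ _ _ _ (fun K => expsum t phi K.+1 n : (R[i])^o)).
  by move: c1; rewrite -(cvg_shiftS (fun K => expsum t phi K n : (R[i])^o)).
have l2' : ((fun K => mulx j (expsum t phi K.+1) n) : nat -> (R[i])^o) K @[K --> \oo]
    --> (expitA t (mulx j phi) n + t%:C * expitA t (iD j phi) n : (R[i])^o).
  under eq_fun do rewrite expsum_mulx.
  apply: (@cvgD _ (R[i])^o).
    by move: c2; rewrite -(cvg_shiftS (fun K => expsum t (mulx j phi) K n : (R[i])^o)).
  apply: (@cvgMr _ _ _ _ (fun K => expsum t (iD j phi) K n : (R[i])^o)).
  exact: c3.
have H := @norm_hausdorff _ (R[i])^o.
by rewrite -(cvg_lim H l1) -(cvg_lim H l2').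
Qed.

(* [s] stands for [1/t]. *)
Definition heis j s phi : state := fun n => s%:C * mulx j phi n + iD j phi n.

Lemma expitA_heis j s phi : s != 0 -> l2 phi -> l2 (mulx j phi) ->
  mulx j (expitA s^-1 phi) = fun n => (s^-1)%:C * expitA s^-1 (heis j s phi) n.
Proof.
move=> s0 h1 h2; apply/funext => n; rewrite expitA_mulx// expitA_linear//; last exact: l2_iD.
by rewrite mulrDr mulrA -rmorphM mulVf// mul1r.
Qed.

Lemma mulxM j (c : R[i]) phi : mulx j (fun n => c * phi n) = fun n => c * mulx j phi n.
Proof. by apply/funext => n; rewrite /mulx mulrCA. Qed.

Lemma iDM j (c : R[i]) phi : iD j (fun n => c * phi n) = fun n => c * iD j phi n.
Proof. by apply/funext => n; rewrite /iD -mulrBr mulrCA. Qed.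

Lemma iDD j phi chi : iD j (fun n => phi n + chi n) = fun n => iD j phi n + iD j chi n.
Proof. by apply/funext => n; rewrite /iD; ring. Qed.

Lemma mulxD j phi chi : mulx j (fun n => phi n + chi n) = fun n => mulx j phi n + mulx j chi n.
Proof. by apply/funext => n; rewrite /mulx mulrDr. Qed.

(** Every coordinate factor crosses the exponential as [s^-1] times [heis]. Square summability is
    required at each stage because each crossing uses convergence of the series on the current
    iterate. *)
Lemma iter_mulx_expitA j s m phi : s != 0 ->
  (forall k, (k < m)%N -> l2 (iter k (heis j s) phi) /\ l2 (mulx j (iter k (heis j s) phi))) ->
  iter m (mulx j) (expitA s^-1 phi) =
  fun n => (s^-1 ^+ m)%:C * expitA s^-1 (iter m (heis j s) phi) n.
Proof.
move=> s0; elim: m => [|m IH] H; first by apply/funext => n; rewrite mul1r.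
rewrite iterS IH; last by move=> k km; apply: H; exact: ltnW.
have [h1 h2] := H m (ltnSn m).
rewrite mulxM expitA_heis//; apply/funext => n.
by rewrite mulrA -rmorphM -exprSr.
Qed.

Lemma absq_iter_mulx j m phi n : absq (iter m (mulx j) phi n) = axis_coord j n ^+ m.*2 * absq (phi n).
Proof.
elim: m => [|m IH]; first by rewrite mul1r.
by rewrite iterS /mulx absqZ IH mulrA -exprD doubleS.
Qed.

(** * Weighted bounds uniform in the parameter [s] *)

Definition wt j (a : nat) n : R := (1 + axis_coord j n ^+ 2) ^+ a.

(** One constant for all s in [0, 1]: the remainder must stay bounded as s tends to 0, and s = 1/t
    lies in this range once t >= 1. *)
Definition wbounded j a (F : R -> state) := exists C : R, forall s, 0 <= s <= 1 ->
  forall N, boxsum N (fun n => wt j a n * absq (F s n)) <= C.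

Lemma wt_ge1 j n : 1 <= 1 + axis_coord j n ^+ 2.
Proof. by rewrite lerDl sqr_ge0. Qed.

Lemma wt_ge0 j a n : 0 <= wt j a n.
Proof. by rewrite exprn_ge0// (le_trans ler01)// wt_ge1. Qed.

Lemma wbounded_dom j a b (c : R) F G : 0 <= c ->
  (forall s n, 0 <= s <= 1 -> wt j a n * absq (F s n) <= c * (wt j b n * absq (G s n))) ->
  wbounded j b G -> wbounded j a F.
Proof.
move=> c0 H [C GC]; exists (c * C) => s s01 N.
apply: (le_trans (ler_boxsum _ (fun n => H s n s01))).
by rewrite boxsumZ; apply: ler_wpM2l => //; exact: GC.
Qed.

Lemma wboundedD j a F G : wbounded j a F -> wbounded j a G ->
  wbounded j a (fun s n => F s n + G s n).
Proof.
move=> [C FC] [D GD]; exists (2 * C + 2 * D) => s s01 N.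
apply: (@le_trans _ _ (2 * boxsum N (fun n => wt j a n * absq (F s n)) +
                       2 * boxsum N (fun n => wt j a n * absq (G s n)))).
  rewrite -!boxsumZ -boxsumD; apply: ler_boxsum => n.
  apply: (le_trans (ler_wpM2l (wt_ge0 _ _ _) (absqD_le _ _))).
  by rewrite le_eqVlt; apply/orP; left; apply/eqP; ring.
by apply: lerD; apply: ler_wpM2l => //; [exact: FC|exact: GD].
Qed.

Lemma wboundedM j a (c : R[i]) F : wbounded j a F -> wbounded j a (fun s n => c * F s n).
Proof.
apply: (@wbounded_dom j a a (absq c)); first exact: absq_ge0.
by move=> s n _; rewrite absqM mulrCA.
Qed.

Lemma wbounded_small j a F : wbounded j a F -> wbounded j a (fun s n => s%:C * F s n).
Proof.
apply: (@wbounded_dom j a a 1) => // s n /andP[s0 s1].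
rewrite mul1r absqZ; apply: ler_wpM2l; first exact: wt_ge0.
by rewrite ler_piMl ?absq_ge0// exprn_ile1.
Qed.

Lemma wbounded_le j a b F : (a <= b)%N -> wbounded j b F -> wbounded j a F.
Proof.
move=> ab; apply: (@wbounded_dom j a b 1) => // s n _.
rewrite mul1r; apply: ler_wpM2r; first exact: absq_ge0.
by rewrite ler_weXn2l// wt_ge1.
Qed.

Lemma wbounded_mulx j a F : wbounded j a.+1 F -> wbounded j a (fun s => mulx j (F s)).
Proof.
apply: (@wbounded_dom j a a.+1 1) => // s n _.
rewrite mul1r /mulx absqZ mulrA; apply: ler_wpM2r; first exact: absq_ge0.
by rewrite /wt [leRHS]exprSr; apply: ler_wpM2l; [exact: wt_ge0|rewrite lerDr].
Qed.

(** Peetre's inequality 1 + x^2 <= 2 (1 + y^2) (1 + (x + y)^2) compares the weight with its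
    translate. *)
Lemma wbounded_shift j a v F : wbounded j a F -> wbounded j a (fun s n => F s (n + v)).
Proof.
move=> [C FC]; have [M HM] := boxsum_shift_le R v.
pose c := (2 * (1 + axis_coord j v ^+ 2)) ^+ a.
have c0 : 0 <= c by rewrite exprn_ge0// mulr_ge0// (le_trans ler01)// wt_ge1.
exists (c * C) => s s01 N.
apply: (@le_trans _ _ (c * boxsum N (fun n => wt j a (n + v) * absq (F s (n + v))))).
  rewrite -boxsumZ; apply: ler_boxsum => n; rewrite mulrA.
  apply: ler_wpM2r; first exact: absq_ge0.
  rewrite /wt /c -exprMn; apply: lerXn2r; rewrite ?nnegrE.
  - exact: le_trans ler01 (wt_ge1 _ _).
  - by rewrite !mulr_ge0// (le_trans ler01)// wt_ge1.
  - rewrite axis_coordD; move: (axis_coord j n) (axis_coord j v) => x y.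
    have := sqr_ge0 (x + 2 * y); have := sqr_ge0 (y * (x + y)); nra.
apply: ler_wpM2l => //.
apply: (le_trans (HM (fun n => wt j a n * absq (F s n)) N _)) => [n|]; last exact: FC.
by rewrite mulr_ge0 ?wt_ge0 ?absq_ge0.
Qed.

Lemma wbounded_iD j a F : wbounded j a F -> wbounded j a (fun s => iD j (F s)).
Proof.
move=> h; apply: wboundedM.
apply: (@wboundedD j a (fun s n => F s (n - ebasis j)) (fun s n => - F s (n + ebasis j))).
  exact: wbounded_shift.
have := wboundedM (-1) (wbounded_shift (ebasis j) h).
by apply: (@wbounded_dom j a a 1) => // s n _; rewrite mul1r mulN1r.
Qed.

Lemma wbounded_l2 j a F s : 0 <= s <= 1 -> wbounded j a F -> l2 (F s).
Proof.
move=> s01 /(wbounded_le (leq0n a))[C FC]; exists C => N.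
apply: le_trans (FC s s01 N); apply: ler_boxsum => n.
by rewrite ger0_norm ?absq_ge0// mul1r.
Qed.

Lemma wbounded_heis j a F : wbounded j a.+1 F -> wbounded j a (fun s => heis j s (F s)).
Proof.
move=> h; apply: wboundedD.
  exact: wbounded_small (wbounded_mulx h).
by apply: wbounded_iD; exact: wbounded_le h.
Qed.

Lemma wbounded_iter_heis j a k phi : wbounded j (k + a) (fun=> phi) ->
  wbounded j a (fun s => iter k (heis j s) phi).
Proof.
elim: k a => [|k IH] a //= h.
by apply: wbounded_heis; apply: IH; rewrite addnS.
Qed.

Lemma wbounded_iter_iD j a k phi : wbounded j a (fun=> phi) ->
  wbounded j a (fun=> iter k (iD j) phi).
Proof. by elim: k => //= k IH h; apply: wbounded_iD; exact: IH. Qed.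

(** A single remainder must serve all weights a, because the inductive step needs the previous one
    at weight a + 1. *)
Lemma heis_remainder j k phi : exists2 rem : R -> state,
  (forall s, iter k (heis j s) phi = fun n => iter k (iD j) phi n + s%:C * rem s n) &
  forall a, wbounded j (k + a) (fun=> phi) -> wbounded j a rem.
Proof.
elim: k => [|k [rem E B]].
  exists (fun=> fun=> 0) => [s|a _].
    by apply/funext => n; rewrite mulr0 addr0.
  by exists 0 => s _ N; rewrite /boxsum big1// => x _; rewrite absq0 mulr0.
(* Apply [heis] to the decomposition at k, set the next power of [iD] aside, and divide what is left
   by s. *)
exists (fun s n => mulx j (iter k (iD j) phi) n + (s%:C * mulx j (rem s) n + iD j (rem s) n)).
  move=> s; rewrite iterS E; apply/funext => n.
  by rewrite /heis mulxD iDD mulxM iDM /=; ring.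
move=> a; rewrite addSnnS => h; have hr := B _ h.
apply: wboundedD.
  apply: wbounded_mulx; apply: wbounded_iter_iD; apply: wbounded_le h.
  exact: leq_addl.
apply: wboundedD; first exact: wbounded_small (wbounded_mulx hr).
by apply: wbounded_iD; exact: wbounded_le hr.
Qed.

(** With x the squared coordinate, (1 + x)^m <= 2^m max(1, x)^m <= 2^m (1 + x^m). *)
Lemma wbounded_const j m phi : l2 phi ->
  summ (fun n => axis_coord j n ^+ m.*2 * absq (phi n)) -> wbounded j m (fun=> phi).
Proof.
move=> [C hC] [D hD]; exists (2 ^+ m * (C + D)) => s _ N.
apply: le_trans (ler_wpM2l (exprn_ge0 m (ler0n R 2)) (lerD (hC N) (hD N))).
rewrite -boxsumD -boxsumZ; apply: ler_boxsum => n.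
have x0 : 0 <= axis_coord j n ^+ 2 by exact: sqr_ge0.
rewrite normrM !(ger0_norm (absq_ge0 _)) ger0_norm; last first.
  by rewrite -mul2n exprM exprn_ge0.
rewrite -[X in X + _]mul1r -mulrDl mulrA; apply: ler_wpM2r; first exact: absq_ge0.
rewrite -mul2n exprM /wt; move: (axis_coord j n ^+ 2) x0 => x x0.
have [x1|/ltW x1] := lerP x 1.
  apply: (@le_trans _ _ (2 ^+ m)).
    by apply: lerXn2r; rewrite ?nnegrE//; lra.
  by rewrite ler_peMr ?exprn_ge0// lerDl exprn_ge0.
apply: (@le_trans _ _ (2 ^+ m * x ^+ m)).
  by rewrite -exprMn; apply: lerXn2r; rewrite ?nnegrE//; lra.
by apply: ler_wpM2l; [exact: exprn_ge0|rewrite lerDr].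
Qed.

End Heisenberg.

(** * The asymptotic velocity *)

Section Velocity.
Variables (R : realType) (d : nat).
Notation state := ('rV[int]_d -> R[i]).
Implicit Types (phi chi : state) (n v : 'rV[int]_d) (t s : R) (j : 'I_d).

Lemma l2_iter_iD j k phi : l2 phi -> l2 (iter k (iD j) phi).
Proof. by move=> h; elim: k => //= k; exact: l2_iD. Qed.

Lemma rdotBl phi phi' chi : l2 phi -> l2 phi' -> l2 chi ->
  rdot (fun n => phi n - phi' n) chi = rdot phi chi - rdot phi' chi.
Proof.
move=> h1 h2 h3; rewrite -mulN1r -rdotZl// -rdotDl//; last exact: l2M.
by congr rdot; apply/funext => n; rewrite rmorphN1 mulN1r.
Qed.

(** A shift minus its inverse is skew, multiplication by 'i is skew, and the two commute. *)
Lemma rdot_iD j phi chi : l2 phi -> l2 chi -> rdot (iD j phi) chi = rdot phi (iD j chi).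
Proof.
move=> h1 h2; have h3 : l2 (fun n => 'i * chi n) by exact: l2M.
rewrite rdot_iM//; last by apply: l2D; [|apply: l2N]; exact: l2_shift.
rewrite rdotBl//; try exact: l2_shift.
rewrite opprB [RHS]rdotC.
have -> : iD j chi = fun n => 'i * chi (n - ebasis j) - 'i * chi (n + ebasis j).
  by apply/funext => n; rewrite /iD mulrBr.
rewrite rdotBl//; [|exact: (l2_shift _ h3)|exact: (l2_shift _ h3)].
congr (_ - _); first by rewrite rdot_shift// rdotC.
by rewrite (rdot_shift _ h1 h3) opprK rdotC.
Qed.

Lemma rdot_iter_iD j k l phi : l2 phi ->
  rdot (iter k (iD j) phi) (iter l (iD j) phi) = rdot phi (iter (k + l) (iD j) phi).
Proof.
move=> h; elim: k l => [//|k IH] l.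
rewrite iterS rdot_iD; try exact: l2_iter_iD.
by rewrite -iterS IH addnS.
Qed.

(** Binomial theorem for a shift minus its inverse: k forward and N - k backward steps displace by
    2k - N. The induction is Pascal's rule. *)
Lemma iter_iD_expand j N phi n : iter N (iD j) phi n =
  'i ^+ N * \sum_(k < N.+1) 'C(N, k)%:R * (-1) ^+ k *
     phi (n + ebasis j *~ (k%:Z * 2 - N%:Z)).
Proof.
elim: N n => [|N IH] n.
  by rewrite big_ord_recl big_ord0 /= bin0 mul0r subr0 mulr0z !addr0 !mul1r.
pose h (z : int) := phi (n + ebasis j *~ z).
have shm c : phi (n - ebasis j + ebasis j *~ c) = h (-1 + c).
  by rewrite /h mulrzDr addrA mulrN1z.
have shp c : phi (n + ebasis j + ebasis j *~ c) = h (1 + c).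
  by rewrite /h mulrzDr addrA mulr1z.
rewrite iterS /iD !IH -mulrBr mulrA -exprS; congr (_ * _).
under eq_bigr => k _ do rewrite shm.
under [X in _ - X]eq_bigr => k _ do rewrite shp.
under [RHS]eq_bigr => k _ do rewrite -/(h _).
rewrite [RHS]big_ord_recl.
under [X in _ = _ + X]eq_bigr => k _ do rewrite lift0 binS natrD 2!mulrDl.
rewrite big_split /= addrA; congr (_ + _).
  (* The added last term has coefficient C(N, N+1) = 0 and aligns the index ranges. *)
  transitivity (\sum_(k < N.+2) 'C(N, k)%:R * (-1) ^+ k * h (k%:Z * 2 - N.+1%:Z)).
    rewrite [RHS]big_ord_recr /= bin_small// !mul0r addr0; apply: eq_bigr => k _.
    by congr (_ * h _); lia.
  rewrite big_ord_recl !bin0; congr (_ + _).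
rewrite -sumrN; apply: eq_bigr => k _; rewrite exprS mulN1r mulrN mulNr.
by congr (- (_ * h _)); lia.
Qed.

(** The indices q and 2m - q correspond to opposite displacements, the pairs of shifts that make up
    [Sk]. *)
Lemma sum_fold_middle (f : nat -> R) m :
  \sum_(k < m.*2.+1) f k = f m + \sum_(q < m) (f q + f (m.*2 - q)%N).
Proof.
rewrite -addnn -addnS big_split_ord /= big_ord_recl /= addn0.
rewrite big_split /= addrCA; congr (_ + (_ + _)).
rewrite (reindex_inj rev_ord_inj) /=; apply: eq_bigr => q _; congr (f _).
by have := ltn_ord q; rewrite /bump /=; lia.
Qed.

Definition acorr phi j (z : int) : R :=
  rdot phi (fun n => phi (n + ebasis j *~ z)).

Lemma acorr0 phi j : acorr phi j 0 = rdot phi phi.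
Proof. by congr rdot; apply/funext => n; rewrite mulr0z addr0. Qed.

Lemma rdot_Sk_acorr phi k : l2 phi ->
  rdot phi (Sk k phi) = \sum_(j < d) (acorr phi j (- k%:Z) + acorr phi j k%:Z).
Proof.
move=> h; rewrite rdot_sumr//; last by move=> j; apply: l2D; exact: l2_shift.
apply: eq_bigr => j _; rewrite rdotC rdotDl//; try exact: l2_shift.
by congr (_ + _); rewrite rdotC; congr rdot; apply/funext => n; rewrite ?mulrNz.
Qed.

Lemma rdot_velocity j m phi : l2 phi ->
  rdot (iter m (iD j) phi) (iter m (iD j) phi) =
  'C(m.*2, m)%:R * rdot phi phi +
  \sum_(q < m) 'C(m.*2, q)%:R * (-1) ^+ (q + m) *
     (acorr phi j (- (m.*2 - q.*2)%N%:Z) + acorr phi j (m.*2 - q.*2)%N%:Z).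
Proof.
move=> h; rewrite rdot_iter_iD// addnn.
pose f k : R := (-1) ^+ m * ('C(m.*2, k)%:R * (-1) ^+ k) * acorr phi j (k%:Z * 2 - m.*2%:Z).
have i2 : 'i ^+ m.*2 = ((-1) ^+ m)%:C :> R[i].
  by rewrite -mul2n exprM sqr_i rmorphXn rmorphN1.
transitivity (\sum_(k < m.*2.+1) f k).
  rewrite (_ : iter _ _ _ = fun n => \sum_(k < m.*2.+1)
      ((-1) ^+ m * ('C(m.*2, k)%:R * (-1) ^+ k))%:C *
      phi (n + ebasis j *~ (k%:Z * 2 - m.*2%:Z))); last first.
    apply/funext => n; rewrite iter_iD_expand i2 mulr_sumr; apply: eq_bigr => k _.
    by rewrite !rmorphM !rmorphXn !rmorphN1 rmorph_nat !mulrA.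
  rewrite rdot_sumr//; last by move=> k; apply: l2M; exact: l2_shift.
  apply: eq_bigr => k _; rewrite rdotC rdotZl//; last exact: l2_shift.
  by rewrite rdotC.
rewrite sum_fold_middle /f; congr (_ + _).
  rewrite (_ : m%:Z * 2 - m.*2%:Z = 0) ?acorr0; last by lia.
  by rewrite mulrCA -exprD addnn -signr_odd odd_double mulr1.
apply: eq_bigr => q _; have qm := ltn_ord q.
have -> : ((m.*2 - q)%N%:Z * 2 - m.*2%:Z = (m.*2 - q.*2)%N%:Z)%R by lia.
have -> : (q%:Z * 2 - m.*2%:Z = - (m.*2 - q.*2)%N%:Z)%R by lia.
rewrite bin_sub; last by lia.
have -> : (-1) ^+ (m.*2 - q) = (-1) ^+ q :> R.
  by rewrite -signr_odd oddB ?odd_double ?signr_odd//; lia.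
by rewrite exprD; ring.
Qed.

Lemma rdot_iD_le j phi : l2 phi -> rdot (iD j phi) (iD j phi) <= 4 * rdot phi phi.
Proof.
move=> h; have hs v : l2 (fun n => phi (n + v)) by exact: l2_shift.
have hN : l2 (fun n => - phi (n + ebasis j)) by exact: l2N.
have hD : l2 (fun n => phi (n - ebasis j) - phi (n + ebasis j)) by exact: l2D.
apply: (@le_trans _ _ (1 * rdot (fun n => phi (n - ebasis j) - phi (n + ebasis j))
                      (fun n => phi (n - ebasis j) - phi (n + ebasis j)))).
  apply: ler_rdot => //; first exact: l2_iD.
  by move=> n; rewrite absq_iM mul1r.
rewrite mul1r; apply: (le_trans (rdotD_le _ hN)); first exact: hs.
have : rdot (fun n => - phi (n + ebasis j)) (fun n => - phi (n + ebasis j))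
    <= 1 * rdot (fun n => phi (n + ebasis j)) (fun n => phi (n + ebasis j)).
  by apply: ler_rdot => // n; rewrite absqN mul1r.
by rewrite mul1r !rdot_shift2//; lra.
Qed.

Lemma rdot_iter_iD_le j m phi : l2 phi ->
  rdot (iter m (iD j) phi) (iter m (iD j) phi) <= 4 ^+ m * rdot phi phi.
Proof.
move=> h; elim: m => [|m IH]; first by rewrite mul1r.
apply: (le_trans (rdot_iD_le _ (l2_iter_iD _ _ h))).
by rewrite (exprS 4 m) -[leRHS]mulrA; apply: ler_wpM2l.
Qed.

(* A kernel element is 2-periodic along the axis [j], hence not square
   summable unless it vanishes. *)
Lemma iD_eq0 j phi : l2 phi -> (forall n, iD j phi n = 0) -> forall n, phi n = 0.
Proof.
move=> h D0 n.
have per m : phi (m + ebasis j *+ 2) = phi m.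
  have /eqP := D0 (m + ebasis j); rewrite /iD mulf_eq0 subr_eq0 => /orP[|/eqP].
    by rewrite eq_complex /= oner_eq0 andbF.
  by rewrite addrK -addrA => ->.
have perk k : phi (n + (ebasis j *+ 2) *+ k) = phi n.
  by elim: k => [|k IH]; rewrite ?mulr0n ?addr0// mulrSr addrA per.
apply: absq_eq0; apply/eqP; rewrite eq_le absq_ge0 andbT leNgt; apply/negP => a0.
set a := absq (phi n) in a0; pose Q := rdot phi phi.
have Q0 : 0 <= Q by exact: rdot_ge0.
pose K := Num.Def.archi_bound (Q / a).
have KQ : Q < K%:R * a by rewrite -ltr_pdivrMr// archi_boundP// divr_ge0// ltW.
pose s := [seq n + (ebasis j *+ 2) *+ k | k <- iota 0 K].
have us : uniq s.
  rewrite map_inj_uniq ?iota_uniq// => k l /addrI/rowP/(_ j).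
  by rewrite !mulmxnE !mxE !eqxx /=; lia.
have [N sN] := sub_box s.
have := ler_sum_box (f := fun n => absq (phi n)) (fun=> absq_ge0 _) us sN.
rewrite big_map; under eq_bigr do rewrite perk.
rewrite big_const_seq count_predT size_iota iter_addr_0 => H.
have : boxsum N (fun n => absq (phi n)) <= Q.
  by rewrite /Q -l2normsqE; apply: (boxsum_le_tsum (f := fun n => absq (phi n))) => // ?; exact: absq_ge0.
by move=> /(le_trans H); rewrite -mulr_natl leNgt KQ.
Qed.

Lemma rdot_iter_iD_gt0 j m phi : l2 phi -> phi <> (fun=> 0) ->
  0 < rdot (iter m (iD j) phi) (iter m (iD j) phi).
Proof.
move=> h phi0; rewrite lt_neqAle rdot_ge0 ?andbT; last exact: l2_iter_iD.
apply/eqP => /esym H; apply: phi0; apply/funext.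
have {H}: forall n, iter m (iD j) phi n = 0.
  move=> n; apply: absq_eq0; apply/eqP; rewrite eq_le absq_ge0 andbT -H.
  by apply: absq_le_rdot; exact: l2_iter_iD.
elim: m => // m IH H; apply: IH; apply: (iD_eq0 (j := j)) => //.
exact: l2_iter_iD.
Qed.

(** The imaginary part is the real pairing of i phi with S_k phi. As S_k is symmetric and commutes
    with the skew multiplication by 'i, this equals its own negative. *)
Lemma l2inner_Sk phi k : l2 phi ->
  l2inner phi (Sk k phi) = (rdot phi (Sk k phi))%:C.
Proof.
move=> h; have hS := l2_Sk k h; have hi : l2 (fun n => 'i * phi n) by exact: l2M.
have hiS : l2 (fun n => 'i * Sk k phi n) by exact: l2M.
have im0 : rdot (fun n => 'i * phi n) (Sk k phi) = 0.
  have : rdot (fun n => 'i * phi n) (Sk k phi) = - rdot (fun n => 'i * phi n) (Sk k phi).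
    rewrite -{1}rdot_Sk// (_ : Sk k _ = fun n => 'i * Sk k phi n).
      by rewrite rdot_iM// rdotC.
    apply/funext => n; rewrite /Sk mulr_sumr.
    by apply: eq_bigr => j _; rewrite mulrDr.
  by move: (rdot _ _) => r; lra.
apply: (@cvg_lim (R[i])^o); first exact: norm_hausdorff.
have reE N : complex.Re (boxsum N (fun n => (phi n)^* * Sk k phi n)) =
    boxsum N (fun n => dotc (phi n) (Sk k phi n)).
  rewrite /boxsum (big_morph (@complex.Re R) (id1 := 0) (op1 := +%R))//; last by case=> ? ? [].
  by apply: eq_bigr => x _; case: (phi _) (Sk _ _ _) => [a b] [c e]; rewrite /dotc /=; ring.
have imE N : complex.Im (boxsum N (fun n => (phi n)^* * Sk k phi n)) =
    boxsum N (fun n => dotc ('i * phi n) (Sk k phi n)).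
  rewrite /boxsum (big_morph (@complex.Im R) (id1 := 0) (op1 := +%R))//; last by case=> ? ? [].
  by apply: eq_bigr => x _; case: (phi _) (Sk _ _ _) => [a b] [c e]; rewrite /dotc /=; ring.
apply: cvg_complex.
  by under eq_fun do rewrite reE; apply: summ_cvg; exact: summ_dotc.
by under eq_fun do rewrite imE; rewrite /= -im0; apply: summ_cvg; exact: summ_dotc.
Qed.

Lemma moment_axis j m phi : moment_finite m phi ->
  summ (fun n => axis_coord R j n ^+ m.*2 * absq (phi n)).
Proof.
have ge0 i n : 0 <= axis_coord R i n ^+ m.*2 * absq (phi n).
  by rewrite mulr_ge0 ?absq_ge0// -mul2n exprM exprn_ge0// sqr_ge0.
move=> mf; have sm : summ (moment_summand m phi).
  by apply: cvgn_summ mf => n; apply: sumr_ge0 => i _; exact: ge0.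
apply: summ_le sm => n; rewrite ger0_norm//.
by rewrite /moment_summand (bigD1 j)//= lerDl; apply: sumr_ge0 => i _; exact: ge0.
Qed.

Lemma rdot_heis_limit j m phi : wbounded j m (fun=> phi) -> exists C : R,
  forall s, 0 <= s <= 1 -> `|rdot (iter m (heis j s) phi) (iter m (heis j s) phi)
     - rdot (iter m (iD j) phi) (iter m (iD j) phi)| <= C * s.
Proof.
move=> h; have [rem E] := heis_remainder j m phi.
rewrite -{1}(addn0 m) in h; move=> /(_ 0%N h) hr.
have lphi : l2 phi by apply: (@wbounded_l2 _ _ j _ (fun=> phi) 0 _ h); rewrite lexx ler01.
set a := iter m (iD j) phi; have la : l2 a by exact: l2_iter_iD.
(* The difference is s^2 |r|^2 + 2 s <a, r>. With s <= 1 the first term is at most s C, and by Young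
   the second is at most s (|a|^2 + C) in absolute value. *)
have [C HC] := hr; exists (2 * C + rdot a a) => s s01.
have /andP[s0 s1] := s01.
have lr : l2 (rem s) by exact: wbounded_l2 s01 hr.
have rC : rdot (rem s) (rem s) <= C.
  rewrite -l2normsqE; apply: (tsum_le_ub lr) => N.
  by apply: le_trans (HC s s01 N); apply: ler_boxsum => n; rewrite mul1r.
rewrite E rdotD//; last exact: l2M.
have lsr : l2 (fun n => s%:C * rem s n) by exact: l2M.
have Zr chi : l2 chi -> rdot chi (fun n => s%:C * rem s n) = s * rdot chi (rem s).
  by move=> lchi; rewrite rdotC rdotZl// rdotC.
rewrite !Zr// rdotZl//.
have r0 := rdot_ge0 lr; have a0 := rdot_ge0 la.
have := rdot_young ltr01 la lr; rewrite invr1 !ler_norml => /andP[].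
move: (rdot a a) (rdot (rem s) (rem s)) (rdot a (rem s)) r0 a0 rC => A B X B0 A0 BC X1 X2.
have sX1 : s * (- (1 / 2 * A + 1 / 2 * B)) <= s * X by exact: ler_wpM2l.
have sX2 : s * X <= s * (1 / 2 * A + 1 / 2 * B) by exact: ler_wpM2l.
have sB : s * B <= s * C by exact: ler_wpM2l.
have ssB : 0 <= s * (s * B) by rewrite !mulr_ge0.
have ssB2 : s * (s * B) <= s * B by rewrite ler_piMl// mulr_ge0.
by apply/andP; split; nra.
Qed.

(** An exact identity at each such time. Its pointwise form also shows that the moment of the
    evolved state is finite, since it equals a sum of squared norms of l^2 states. *)
Lemma moment_expitA m phi s : 0 < s <= 1 -> l2 phi -> moment_finite m phi ->
  moment_normsq m (expitA s^-1 phi) / s^-1 ^+ m.*2 =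
  \sum_(j < d) rdot (iter m (heis j s) phi) (iter m (heis j s) phi).
Proof.
move=> /andP[s0 s1] h mf; have s01 : 0 <= s <= 1 by rewrite ltW.
have wb j : wbounded j m (fun=> phi) by apply: wbounded_const => //; exact: moment_axis.
pose G j := iter m (heis j s) phi.
have lG j : l2 (G j).
  apply: (@wbounded_l2 _ _ j 0 (fun s => iter m (heis j s) phi)) => //.
  by apply: wbounded_iter_heis; rewrite addn0.
have E j n : axis_coord R j n ^+ m.*2 * absq (expitA s^-1 phi n) =
    s^-1 ^+ m.*2 * absq (expitA s^-1 (G j) n).
  rewrite -absq_iter_mulx iter_mulx_expitA ?gt_eqF//.
    by rewrite absqZ -exprM muln2.
  (* As k < m, at least one power of the weight is left, which pays for the extra factor
     [mulx j]. *)
  move=> k km; have wk : wbounded j 1 (fun s => iter k (heis j s) phi).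
    by apply: wbounded_iter_heis; apply: wbounded_le (wb j); rewrite addn1.
  split; first exact: (wbounded_l2 s01 wk).
  exact: (wbounded_l2 s01 (wbounded_mulx wk)).
have -> : moment_normsq m (expitA s^-1 phi) =
    tsum (fun n => \sum_(j < d) s^-1 ^+ m.*2 * absq (expitA s^-1 (G j) n)).
  congr tsum; apply/funext => n; apply: eq_bigr => j _; exact: E.
have lU j : l2 (expitA s^-1 (G j)) by exact: l2_expitA.
rewrite tsum_sum; last by move=> j; exact: summZ (lU j).
rewrite mulr_suml; apply: eq_bigr => j _.
rewrite tsumZ; last exact: lU.
rewrite mulrAC divff ?mul1r; last by rewrite expf_neq0// invr_neq0// gt_eqF.
by rewrite -(rdot_expitA s^-1 (lG j)) -l2normsqE.
Qed.

End Velocity.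

Theorem theorem2p1 (R : realType) (d m : nat) (psi : 'rV[int]_d -> R[i]) :
  (0 < d)%N ->
  in_l2 psi ->
  moment_finite m psi ->
  exists L : R,
    (moment_normsq m (expitA t psi) / t ^+ (m.*2) @[t --> +oo] --> L)
    /\ L%:C = (d%:R * 'C(m.*2, m)%:R * (l2normsq psi)%:C
               + \sum_(q < m) 'C(m.*2, q)%:R * (-1) ^+ (q + m)
                              * l2inner psi (Sk (m.*2 - q.*2) psi))
    /\ (psi <> (fun _ => 0) -> 0 < L)
    /\ L <= 4 ^+ m * d%:R * l2normsq psi.
Proof.
move=> d0 /in_l2P h mf.
pose V j := rdot (iter m (iD j) psi) (iter m (iD j) psi).
have V0 j : 0 <= V j by apply: rdot_ge0; exact: l2_iter_iD.
exists (\sum_(j < d) V j); split; [|split; [|split]].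
- have wb j : wbounded j m (fun=> psi) by apply: wbounded_const => //; exact: moment_axis.
  have [C HC] := choice (fun j => rdot_heis_limit (wb j)).
  pose D := \sum_(j < d) C j.
  apply/cvgrPdist_le => e e0; near=> t.
  have t1 : 1 <= t by near: t; apply: nbhs_pinfty_ge; rewrite num_real.
  (* The errors of all axes add up to at most D / t, which this threshold makes at most e. *)
  have tD : D / e <= t by near: t; apply: nbhs_pinfty_ge; rewrite num_real.
  have t0 : 0 < t by exact: lt_le_trans t1.
  have s01 : 0 < t^-1 <= 1 by rewrite invr_gt0 t0 invf_le1.
  have := moment_expitA s01 h mf; rewrite invrK => ->.
  rewrite distrC -sumrB; apply: (le_trans (ler_norm_sum _ _ _)).
  apply: (@le_trans _ _ (D / t)).
    rewrite mulr_suml; apply: ler_sum => j _; apply: HC.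
    by case/andP: s01 => /ltW -> ->.
  by rewrite ler_pdivrMr// mulrC -ler_pdivrMr.
- rewrite (eq_bigr _ (fun j _ => rdot_velocity j m h)) big_split /= sumr_const card_ord.
  (* For fixed q, summing the autocorrelations over the axes rebuilds the pairing with S_(2m -
     2q). *)
  rewrite exchange_big /= rmorphD rmorph_sum /= l2normsqE; congr (_ + _).
    by rewrite rmorphMn rmorphM rmorph_nat -mulr_natl mulrA.
  apply: eq_bigr => q _; rewrite l2inner_Sk// rdot_Sk_acorr// -mulr_sumr.
  by rewrite !rmorphM rmorph_nat rmorphXn rmorphN1.
(* One axis, present because d > 0, already gives a positive term. *)
- move=> psi0; rewrite (bigD1 (Ordinal d0))//= ltr_pwDl//; last exact: sumr_ge0.
  exact: rdot_iter_iD_gt0.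
- rewrite l2normsqE; apply: (le_trans (ler_sum _ (fun j _ => rdot_iter_iD_le j m h))).
  by rewrite sumr_const card_ord -[leLHS]mulr_natr mulrAC.
Unshelve. all: by end_near. Qed.
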